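(* Let $\varepsilon>0$ and let $r\ge 2$ be an integer. There exists $d^*>0$ such that for any $d\ge d^*$ there exist $\eta, C_1, C_2, n^*>0$ such that the following holds for any $n\ge n^*$, $\xi\ge 1$, $1\le D\le \frac{C_1 n}{\xi\log n}$, and $\delta\le \exp(-C_2\xi D\log n)$: with $p=d/\binom{n-1}{r-1}$, if $k\ge n(1+\varepsilon)\left(\frac{1}{r-1}\cdot\frac{\log d}{d}\right)^{1/(r-1)}$, then there is no random polynomial of degree at most $D$ that $(k,\delta,\xi,\eta)$-optimizes the independent set problem in $\mathcal{H}_r(n,p)$.
   Context: $\mathcal{H}_r(n,p)$ is the random $r$-uniform hypergraph on vertex set $[n]$ in which each $r$-subset of $[n]$ is an edge independently with probability $p$; it is encoded by its edge-indicator vector $A\in\{0,1\}^m$, $m=\binom{n}{r}$. An independent set is a vertex set containing no edge. A random polynomial of degree $D$ is a function $f:\mathbb{R}^m\times\Omega\to\mathbb{R}^n$ on a probability space $(\Omega,P)$ such that for each $\omega$, every coordinate $f_i(\cdot,\omega)$ is a multivariate polynomial of degree at most $D$ (coefficients random but independent of $A$). Rounding: for $\eta>0$, let $I=\{i: f_i(A,\omega)\ge 1\}$, $\tilde I=\{i\in I: \text{no edge } e\ni i \text{ of } A \text{ has } e\subseteq I\}$, $J=\{i: f_i(A,\omega)\in(1/2,1)\}$, and $V^\eta_f(A,\omega)=\tilde I$ if $|I\setminus\tilde I|+|J|\le\eta n$, and $\emptyset$ otherwise. $f$ $(k,\delta,\xi,\eta)$-optimizes the independent set problem in $\mathcal{H}_r(n,p)$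 if, for $A\sim\mathcal{H}_r(n,p)$ independent of $\omega$: $\mathbb{E}_{A,\omega}\|f(A,\omega)\|^2\le\xi k$ and $\mathbb{P}_{A,\omega}[|V^\eta_f(A,\omega)|\ge k]\ge 1-\delta$. *)

(* Defs.v *)
From HB Require Import structures.
From mathcomp Require Import all_boot all_order all_algebra.
From mathcomp Require Import all_classical all_reals all_analysis.
Set Implicit Arguments. Unset Strict Implicit. Unset Printing Implicit Defensive.
Import Order.TTheory GRing.Theory Num.Theory.
Local Open Scope ring_scope.

Definition redge (n r : nat) := {e : {set 'I_n} | #|e| == r}.

Definition hgraph (n r : nat) := {ffun redge n r -> bool}.

Section Defs.
Variable R : realType.

Definition aval (n r : nat) (A : hgraph n r) : redge n r -> R :=
  fun e => ((A e : nat)%:R : R).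

Definition hprob (n r : nat) (p : R) (A : hgraph n r) : R :=
  \prod_(e : redge n r) (if A e then p else 1 - p).

Definition poly_deg_le (E : finType) (D : nat) (g : (E -> R) -> R) : Prop :=
  exists s : seq ({ffun E -> nat} * R),
    (forall t, t \in s -> (\sum_(e : E) t.1 e <= D)%N) /\
    (forall x : E -> R,
        g x = \sum_(t <- s) t.2 * \prod_(e : E) x e ^+ t.1 e).

(* A random polynomial of degree at most D from R^m x Omega to R^n, on a
   probability space (T, P): for each omega every coordinate is a polynomial
   of degree <= D; coefficients depend on omega measurably (so that the
   expectations/probabilities below make sense). *)
Definition random_poly (n r : nat) (D : nat) (dT : measure_display)
  (T : measurableType dT) (f : (redge n r -> R) -> T -> 'I_n -> R) : Prop :=
  (forall (w : T) (i : 'I_n), poly_deg_le D (fun x => f x w i)) /\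
  (forall (A : hgraph n r) (i : 'I_n),
      measurable_fun setT (fun w => f (aval A) w i)).

Definition Iset (n : nat) (x : 'I_n -> R) : {set 'I_n} :=
  [set i | 1 <= x i]%SET.

Definition Itil (n r : nat) (A : hgraph n r) (x : 'I_n -> R) : {set 'I_n} :=
  [set i in Iset x | ~~ [exists e : redge n r,
       [&& A e, i \in val e & val e \subset Iset x]]]%SET.

Definition Jset (n : nat) (x : 'I_n -> R) : {set 'I_n} :=
  [set i | (1 / 2 < x i) && (x i < 1)]%SET.

Definition Vround (n r : nat) (eta : R) (A : hgraph n r) (x : 'I_n -> R)
  : {set 'I_n} :=
  if ((#|(Iset x :\: Itil A x)%SET| + #|Jset x|)%:R <= eta * n%:R)
  then Itil A x else finset.set0.

Definition optimizes (n r : nat) (p : R) (k : nat) (delta xi eta : R)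
  (dT : measure_display) (T : measurableType dT) (P : probability T R)
  (f : (redge n r -> R) -> T -> 'I_n -> R) : Prop :=
  ((\sum_(A : hgraph n r) (hprob p A)%:E *
      \int[P]_w (\sum_(i < n) (f (aval A) w i) ^+ 2)%:E
    <= (xi * k%:R)%:E)%E) /\
  (((1 - delta)%:E <=
     \sum_(A : hgraph n r) (hprob p A)%:E *
       P [set w | (k <= #|Vround eta A (f (aval A) w)|)%N]%classic)%E).

End Defs.

(* Main.v *)
Require Import Defs.
From HB Require Import structures.
From mathcomp Require Import all_boot all_order all_algebra.
From mathcomp Require Import all_classical all_reals all_analysis measurable_realfun.
From mathcomp Require Import zify ring lra.
Set Implicit Arguments. Unset Strict Implicit. Unset Printing Implicit Defensive.
Import Order.TTheory GRing.Theory Num.Theory.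
Local Open Scope ring_scope.

(** An ensemble overlap-gap argument. Refresh the edge indicators of a random
    hypergraph one at a time, cyclically, [K] times over. A low-degree polynomial
    has small total influence, so with probability at least
    [exp (- O (xi * D * ln n))] no step of this path moves its output much; if
    rounding also succeeds all along the path, the rounded independent sets
    [V_t] evolve almost continuously. Starting from [a] vertices of [V_0],
    repeatedly wait until [V_t] has [b] vertices outside the current set [U] and
    add them to [U]: this must happen within one full refreshment, because a fresh
    hypergraph has no independent [a]-subset of [U]. At each addition [V_t] still
    has [a] vertices in [U], so the [b * 'C(a, r.-1)] edges joining one new vertex
    to [r - 1] old ones are absent from the hypergraph at time [t]. Once
    [a >= (1 + eps / 2) * Phi * n], the probability of this beats the number of
    choices of the new vertices, and after [K] of order [eps ^- 2] additions it
    also beats the choice of the initial set, so that a first moment bound makes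
    the whole structure exponentially unlikely. *)

(** * Product Bernoulli expectation *)

(** The weights are those of [hprob], over any finite index set: this serves both one hypergraph and
    the table of independent bits that drives the path. *)
Definition pexp (R : realType) (I : finType) (p : R)
    (F : {ffun I -> bool} -> R) : R :=
  \sum_(Y : {ffun I -> bool}) (\prod_(i : I) (if Y i then p else 1 - p)) * F Y.

Definition upd (I : finType) (Y : {ffun I -> bool}) (i : I) (b : bool) :
    {ffun I -> bool} :=
  [ffun j => if j == i then b else Y j].

Section Update.
Variable I : finType.
Implicit Types (Y : {ffun I -> bool}) (i : I).

Lemma upd_same Y i b : upd Y i b i = b.
Proof. by rewrite ffunE eqxx. Qed.

Lemma upd_id Y i : upd Y i (Y i) = Y.
Proof. by apply/ffunP => j; rewrite ffunE; case: eqP => [->|]. Qed.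

Lemma upd_upd Y i b c : upd (upd Y i b) i c = upd Y i c.
Proof. by apply/ffunP => j; rewrite !ffunE; case: eqP. Qed.

Lemma upd_neq Y i b j : j != i -> upd Y i b j = Y j.
Proof. by rewrite ffunE => /negPf ->. Qed.

End Update.

Section ProductExpectation.
Variables (R : realType) (I : finType) (p : R).
Implicit Types (F G : {ffun I -> bool} -> R) (Y : {ffun I -> bool}) (i : I).

Lemma eq_pexp F G : (forall Y, F Y = G Y) -> pexp p F = pexp p G.
Proof. by move=> FG; apply: eq_bigr => Y _; rewrite FG. Qed.

Lemma pexpD F G : pexp p (fun Y => F Y + G Y) = pexp p F + pexp p G.
Proof. by rewrite /pexp -big_split; apply: eq_bigr => Y _; rewrite mulrDr. Qed.

Lemma pexpZ c F : pexp p (fun Y => c * F Y) = c * pexp p F.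
Proof. by rewrite /pexp mulr_sumr; apply: eq_bigr => Y _; rewrite mulrCA. Qed.

Lemma pexp_sum (J : Type) (s : seq J) (P : pred J)
    (F : J -> {ffun I -> bool} -> R) :
  pexp p (fun Y => \sum_(j <- s | P j) F j Y) = \sum_(j <- s | P j) pexp p (F j).
Proof. by rewrite /pexp exchange_big; apply: eq_bigr => Y _; rewrite mulr_sumr. Qed.

Lemma pexp_prod (G : I -> bool -> R) :
  pexp p (fun Y => \prod_i G i (Y i)) =
  \prod_i (p * G i true + (1 - p) * G i false).
Proof.
transitivity (\prod_i \sum_(b : bool) (if b then p else 1 - p) * G i b).
  by rewrite bigA_distr_bigA; apply: eq_bigr => Y _; rewrite big_split.
by apply: eq_bigr => i _; rewrite big_bool.
Qed.

Lemma pexp1 : pexp p (fun _ : {ffun I -> bool} => 1) = 1.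
Proof.
transitivity (pexp p (fun Y : {ffun I -> bool} => \prod_(i : I) (fun _ _ => 1) i (Y i))).
  by apply: eq_pexp => Y; rewrite big1.
by rewrite (pexp_prod (fun _ _ => 1)) big1 // => i _; rewrite !mulr1 addrC subrK.
Qed.

Lemma pexp_cst c : pexp p (fun _ : {ffun I -> bool} => c) = c.
Proof.
rewrite -[RHS]mulr1 -pexp1 -pexpZ.
by apply: eq_pexp => Y; rewrite mulr1.
Qed.

(** The weights of the two values of bit [i] sum to 1, which splits [F Y] into two parts; flipping
    bit [i] in the second part recombines them into an average over that bit. *)
Lemma pexp_resample i F :
  pexp p F =
  pexp p (fun Y => p * F (upd Y i true) + (1 - p) * F (upd Y i false)).
Proof.
pose q (b : bool) : R := if b then p else 1 - p.
pose W (Y : {ffun I -> bool}) := \prod_(j | j != i) q (Y j).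
pose fl (Y : {ffun I -> bool}) := upd Y i (~~ Y i).
have flK : involutive fl.
  by move=> Y; rewrite /fl upd_upd upd_same negbK upd_id.
have Wfl Y : W (fl Y) = W Y.
  by apply: eq_bigr => j ji; rewrite /fl upd_neq.
have wE Y : \prod_j q (Y j) = q (Y i) * W Y by rewrite (bigD1 i).
rewrite /pexp.
transitivity (\sum_(Y : {ffun I -> bool}) (q (Y i) * W Y) * (q (Y i) * F Y) +
              \sum_(Y : {ffun I -> bool}) (q (Y i) * W Y) * (q (~~ Y i) * F (fl Y))).
  rewrite [X in _ = _ + X](reindex_inj (inv_inj flK)) -big_split /=.
  apply: eq_bigr => Y _; rewrite wE Wfl flK /fl upd_same negbK.
  by case: (Y i); rewrite /q /=; ring.
rewrite -big_split; apply: eq_bigr => Y _; rewrite wE /= /fl /q.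
have := upd_id Y i; case: (Y i) => /= ->; ring.
Qed.

(** The bits in [S] are independent of [F]; they are integrated out one by one, each giving a factor
    [1 - p]. *)
Lemma pexp_zero (S : {set I}) F :
  (forall Y i b, i \in S -> F (upd Y i b) = F Y) ->
  pexp p (fun Y => F Y * [forall i in S, ~~ Y i]%:R) = (1 - p) ^+ #|S| * pexp p F.
Proof.
move sk : #|S| => k; elim: k S sk => [|k IH] S sk Finv.
  have S0 : S = finset.set0 by apply/eqP; rewrite -cards_eq0 sk.
  rewrite expr0 mul1r; apply: eq_pexp => Y.
  rewrite S0; have -> : [forall i in finset.set0, ~~ Y i]; last by rewrite mulr1.
  by apply/forall_inP => i; rewrite inE.
have /card_gt0P[i iS] : (0 < #|S|)%N by rewrite sk.
rewrite (pexp_resample i) exprS -mulrA -(IH (S :\ i)%SET); last 2 first.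
- by apply/eqP; rewrite -eqSS -sk (cardsD1 i S) iS.
- by move=> Y j b /setD1P[_ jS]; exact: Finv.
rewrite -pexpZ; apply: eq_pexp => Y; rewrite !Finv //.
have -> : [forall j in S, ~~ upd Y i true j] = false.
  by apply/negbTE/forall_inPn; exists i => //; rewrite upd_same.
have -> : [forall j in S, ~~ upd Y i false j] =
          [forall j in (S :\ i)%SET, ~~ Y j].
  apply/forall_inP/forall_inP => H j.
    by move=> /setD1P[ji jS]; have := H j jS; rewrite upd_neq.
  move=> jS; rewrite ffunE; case: eqP => // /eqP ji.
  by apply: H; rewrite !inE ji.
by rewrite mulr0 mulr0 add0r.
Qed.

Hypotheses (p0 : 0 <= p) (p1 : p <= 1).

Let weight_ge0 Y : 0 <= \prod_i (if Y i then p else 1 - p).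
Proof. by apply: prodr_ge0 => i _; case: ifP => _ //; rewrite subr_ge0. Qed.

Lemma le_pexp F G : (forall Y, F Y <= G Y) -> pexp p F <= pexp p G.
Proof. by move=> FG; apply: ler_sum => Y _; exact: ler_wpM2l. Qed.

Lemma pexp_ge0 F : (forall Y, 0 <= F Y) -> 0 <= pexp p F.
Proof. by move=> F0; apply: sumr_ge0 => Y _; exact: mulr_ge0. Qed.

Lemma pexp_gt_exists F G : pexp p F < pexp p G -> exists Y, F Y < G Y.
Proof.
move=> FG; apply: contrapT => H; move: FG; apply/negP; rewrite -leNgt.
apply: le_pexp => Y; rewrite leNgt; apply/negP => FG; apply: H.
by exists Y.
Qed.

(* Jensen, from [1 + x <= expR x] at [x = ln (F Y) - pexp p (ln \o F)]. *)
Lemma expR_pexp_ln F : (forall Y, 0 < F Y) ->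
  expR (pexp p (fun Y => ln (F Y))) <= pexp p F.
Proof.
move=> F0; set m := pexp _ _.
have H Y : expR m * (1 - m) + expR m * ln (F Y) <= F Y.
  rewrite -mulrDr -[leRHS](lnK (F0 Y)).
  rewrite -[in leRHS](subrK m (ln _)) expRD mulrC ler_wpM2r ?expR_ge0//.
  by have := expR_ge1Dx (ln (F Y) - m); lra.
apply: le_trans (le_pexp H); rewrite pexpD pexp_cst pexpZ -/m; lra.
Qed.

End ProductExpectation.

(** Expanding [F] over point masses turns the left side into products over coordinates; those
    outside the image of [phi] integrate to 1. *)
Lemma pexp_marginal (R : realType) (I J : finType) (p : R) (phi : I -> J)
    (F : {ffun I -> bool} -> R) : injective phi ->
  pexp p (fun Y : {ffun J -> bool} => F [ffun i => Y (phi i)]) = pexp p F.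
Proof.
move=> phi_inj.
transitivity (\sum_(B : {ffun I -> bool}) F B *
  pexp p (fun Y : {ffun J -> bool} =>
     \prod_(j : J) \prod_(i | phi i == j) (Y j == B i)%:R : R)).
  under eq_bigr do rewrite -pexpZ.
  rewrite -pexp_sum; apply: eq_pexp => Y.
  rewrite (bigD1 [ffun i => Y (phi i)]) //= [X in _ + X]big1; last first.
    move=> B BN; have [i Bi] : exists i : I, B i != Y (phi i).
      apply/existsP; rewrite -negb_forall; apply: contra BN => /forallP H.
      by apply/eqP/ffunP => i; rewrite ffunE; exact/eqP/H.
    rewrite (bigD1 (phi i)) //= (bigD1 i) //= eq_sym (negPf Bi).
    by rewrite !mul0r mulr0.
  rewrite big1 ?mulr1 ?addr0// => j _; rewrite big1 // => i /eqP <-.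
  by rewrite ffunE eqxx.
apply: eq_bigr => B _; rewrite mulrC; congr (_ * _).
rewrite (pexp_prod p (fun j b => \prod_(i | phi i == j) (b == B i)%:R)).
rewrite (bigID (mem (phi @: [set: I])%SET)) /= [X in _ * X]big1; last first.
  move=> j jN; rewrite !big1 ?mulr1 1?addrC ?subrK// => i /eqP e;
    by rewrite -e imset_f in jN.
rewrite mulr1 big_imset /=; last by move=> i i' _ _; exact: phi_inj.
apply: eq_big => [i|i _]; first by rewrite inE.
rewrite !(big_pred1 i) => [|j /=|j /=]; try exact: inj_eq.
by case: (B i); rewrite /= ?mulr1 ?mulr0 ?addr0 ?add0r.
Qed.

(** * Total influence of low-degree functions *)

Section LowDegree.
Variables (R : realType) (E : finType) (p : R).
Implicit Types (S : {set E}) (A : {ffun E -> bool}) (c : {set E} -> R).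

(** Unnormalised [p]-biased Fourier characters; distinct ones are orthogonal. *)
Definition pchar_fun S A : R := \prod_(e in S) ((A e)%:R - p).

Definition low_degree (D : nat) (g : {ffun E -> bool} -> R) :=
  exists c, (forall S, c S != 0 -> (#|S| <= D)%N) /\
            forall A, g A = \sum_S c S * pchar_fun S A.

Lemma pexp_pchar S S' :
  pexp p (fun A => pchar_fun S A * pchar_fun S' A) =
  if S == S' then (p * (1 - p)) ^+ #|S| else 0.
Proof.
pose G S e (b : bool) : R := if e \in S then b%:R - p else 1.
transitivity (pexp p (fun A => \prod_e (G S e (A e) * G S' e (A e)))).
  apply: eq_pexp => A; rewrite big_split /pchar_fun.
  by congr (_ * _); rewrite big_mkcond.
rewrite (pexp_prod p (fun e b => G S e b * G S' e b)).
case: eqP => [<-|/eqP].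
  rewrite -prodr_const [RHS]big_mkcond; apply: eq_bigr => e _; rewrite /G.
  by case: (e \in S) => /=; ring.
rewrite finset.eqEsubset negb_and => H.
have [e He] : exists e, (e \in S) != (e \in S').
  apply/existsP; rewrite -negb_forall; apply: contraL H => /forallP H.
  rewrite negb_or !negbK; apply/andP; split; apply/fintype.subsetP => e;
    by rewrite (eqP (H e)).
rewrite (bigD1 e) //= /G; move: He.
by case: (e \in S); case: (e \in S') => //= _; ring.
Qed.

Lemma pexp_sqr_pchar c :
  pexp p (fun A => (\sum_S c S * pchar_fun S A) ^+ 2) =
  \sum_S c S ^+ 2 * (p * (1 - p)) ^+ #|S|.
Proof.
transitivity (\sum_S \sum_S' c S * c S' *
   pexp p (fun A => pchar_fun S A * pchar_fun S' A)).
  under eq_bigr => S _ do under eq_bigr => S' _ do rewrite -pexpZ.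
  under eq_bigr => S _ do rewrite -pexp_sum.
  rewrite -pexp_sum; apply: eq_pexp => A.
  rewrite expr2 mulr_suml; apply: eq_bigr => S _.
  by rewrite mulr_sumr; apply: eq_bigr => S' _; rewrite mulrACA.
apply: eq_bigr => S _; rewrite (bigD1 S) //= big1 => [|S' S'S].
  by rewrite addr0 pexp_pchar eqxx expr2.
by rewrite pexp_pchar eq_sym (negPf S'S) mulr0.
Qed.

Lemma pchar_fun_diff S A e :
  pchar_fun S (upd A e true) - pchar_fun S (upd A e false) =
  if e \in S then pchar_fun (S :\ e)%SET A else 0.
Proof.
have H b : \prod_(i in (S :\ e)%SET) ((upd A e b i)%:R - p) = pchar_fun (S :\ e)%SET A.
  by apply: eq_bigr => i /finset.setD1P[ie _]; rewrite upd_neq.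
case: ifP => eS.
  rewrite [in LHS]/pchar_fun !(big_setD1 e eS) /= !H !upd_same mulr1n mulr0n; ring.
rewrite /pchar_fun -[RHS](subrr (pchar_fun S A)); congr (_ - _);
  by apply: eq_bigr => i iS; rewrite upd_neq //; apply: contraFneq eS => <-.
Qed.

(** Differencing in [e] deletes [e] from the characters containing it and kills the others. By
    orthogonality, each [S] is then counted [#|S| <= D] times in the total. *)
Lemma total_influence D g : 0 <= p -> p <= 1 -> low_degree D g ->
  p * (1 - p) * \sum_e pexp p (fun A => (g (upd A e true) - g (upd A e false)) ^+ 2)
  <= D%:R * pexp p (fun A => g A ^+ 2).
Proof.
move=> p0 p1 [c [cD gE]].
have v0 : 0 <= p * (1 - p) by rewrite mulr_ge0 // subr_ge0.
have -> : pexp p (fun A => g A ^+ 2) = \sum_S c S ^+ 2 * (p * (1 - p)) ^+ #|S|.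
  by rewrite -pexp_sqr_pchar; apply: eq_pexp => A; rewrite gE.
have HE e : pexp p (fun A => (g (upd A e true) - g (upd A e false)) ^+ 2) =
    \sum_(S : {set E} | e \in S) c S ^+ 2 * (p * (1 - p)) ^+ #|S|.-1.
  (* Reindexing by [S :\ e] writes the difference in characters, with coefficient zero at sets
     containing [e], so that orthogonality applies. *)
  transitivity (\sum_(S : {set E})
     (if e \in S then 0 else c (e |: S)%SET) ^+ 2 * (p * (1 - p)) ^+ #|S|).
    rewrite -pexp_sqr_pchar; apply: eq_pexp => A; congr (_ ^+ 2).
    rewrite !gE -sumrB.
    transitivity (\sum_(S : {set E} | e \in S) c S * pchar_fun (S :\ e)%SET A).
      rewrite [RHS]big_mkcond; apply: eq_bigr => S _.
      by rewrite -mulrBr pchar_fun_diff; case: ifP => //; rewrite mulr0.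
    rewrite (reindex_onto (fun S => e |: S)%SET (fun S => S :\ e)%SET) /=; last first.
      by move=> S eS; rewrite finset.setD1K.
    rewrite [RHS](bigID (fun S : {set E} => e \in S)) /= [X in _ = X + _]big1 ?add0r.
      apply: eq_big => S.
        rewrite setU11 /=; apply/eqP/idP => [<-|eS]; first by rewrite !inE eqxx.
        by rewrite setU1K.
      rewrite setU11 /= => /eqP SE; rewrite SE.
      by case: ifP => // eS; move: eS; rewrite -SE !inE eqxx.
    by move=> S ->; rewrite mul0r.
  rewrite [RHS](reindex_onto (fun S => e |: S)%SET (fun S => S :\ e)%SET) /=; last first.
    by move=> S eS; rewrite finset.setD1K.
  rewrite (bigID (fun S : {set E} => e \in S)) /= big1 ?add0r; last first.
    by move=> S ->; rewrite expr0n mul0r.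
  apply: eq_big => S.
    rewrite setU11 /=; apply/idP/eqP => [eS|<-]; last by rewrite !inE eqxx.
    by rewrite setU1K.
  by move=> eS; rewrite (negPf eS) cardsU1 eS.
under eq_bigr do rewrite HE.
rewrite [leLHS]mulr_sumr.

have -> : \sum_(i : E) p * (1 - p) *
    (\sum_(S : {set E} | i \in S) c S ^+ 2 * (p * (1 - p)) ^+ #|S|.-1) =
    \sum_(S : {set E}) #|S|%:R * (c S ^+ 2 * (p * (1 - p)) ^+ #|S|).
  under eq_bigr do rewrite mulr_sumr.
  rewrite (exchange_big_dep xpredT) //=; apply: eq_bigr => S _.
  rewrite mulr_natl -sumr_const; apply: eq_bigr => e eS.
  rewrite mulrCA -exprS prednK //.
  by apply/card_gt0P; exists e.
rewrite mulr_sumr; apply: ler_sum => S _.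
have [cS|cS] := eqVneq (c S) 0; first by rewrite cS expr0n /= mul0r !mulr0.
by rewrite ler_wpM2r ?ler_nat ?cD // mulr_ge0 ?sqr_ge0 ?exprn_ge0.
Qed.

(** On 0/1 inputs a positive power of [x] equals [x = (x - p) + p]. Expanding a monomial gives only
    characters supported on its variables, and there are at most [D] of these variables. *)
Lemma poly_deg_le_low_degree D (g : (E -> R) -> R) : poly_deg_le D g ->
  low_degree D (fun A => g (fun e => (A e)%:R)).
Proof.
case=> s [sD gE].
(* The coefficient of the character of [S] in the monomial [t]; it vanishes unless [S] lies in the
   support of [t]. *)
pose mc (t : {ffun E -> nat}) S : R :=
  \prod_e (if e \in S then (t e != 0)%:R else if t e == 0 then 1 else p).
exists (fun S => \sum_(t <- s) t.2 * mc t.1 S); split.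
  move=> S; apply: contraNT; rewrite -ltnNge => DS.
  rewrite big_seq big1 // => t ts; have := sD t ts => tD.
  have [e eS te] : exists2 e, e \in S & t.1 e = 0.
    apply: contrapT => H; move: DS; apply/negP; rewrite -leqNgt.
    apply: leq_trans tD; rewrite -sum1_card big_mkcond leq_sum // => e _.
    by case: ifP => // eS; rewrite lt0n; apply/eqP => te; apply: H; exists e.
  by rewrite /mc (bigD1 e) //= eS te eqxx /= mul0r mulr0.
move=> A; rewrite gE.
under [RHS]eq_bigr => S _ do rewrite mulr_suml.
rewrite exchange_big; apply: eq_bigr => t _ /=.
under [RHS]eq_bigr => S _ do rewrite -mulrA.
rewrite -mulr_sumr; congr (_ * _).
transitivity (\prod_(e : E) ((if t.1 e == 0 then 0 else (A e)%:R - p) +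
                             (if t.1 e == 0 then 1 else p))).
  apply: eq_bigr => e _; case: eqP => [->|/eqP te]; first by rewrite add0r expr0.
  by rewrite subrK; case: (A e); rewrite ?expr1n // expr0n (negPf te).
rewrite bigA_distr; apply: eq_bigr => S _.
rewrite /mc /pchar_fun [X in _ = _ * X]big_mkcond -big_split; apply: eq_bigr => e _ /=.
by case: (e \in S); case: eqP => //= _; rewrite ?mul0r ?mul1r ?mulr1.
Qed.

End LowDegree.

(** * The interpolation path *)

Section Path.
Variables (E : finType).
Implicit Types (A : {ffun E -> bool}) (e : E).

Variable e0 : E.
Local Notation m := #|E|.

Definition coord (t : nat) : E := nth e0 (enum E) (t %% m).

Definition ver (t : nat) (e : E) : nat :=
  (t %/ m + (index e (enum E) < t %% m))%N.

(* The interpolation path: coordinates are refreshed cyclically, one per step,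
   and [ver t e] counts the updates of [e] before time [t]. *)
Definition ipath (K : nat) (Y : {ffun 'I_K.+1 * E -> bool}) (t : nat) :
    {ffun E -> bool} :=
  [ffun e => Y (inord (ver t e), e)].

Let m0 : (0 < m)%N. Proof. by apply/card_gt0P; exists e0. Qed.

Lemma ver_succ t e : ver t.+1 e = (ver t e + (e == coord t))%N.
Proof.
have im : (index e (enum E) < m)%N by rewrite cardE index_mem mem_enum.
have -> : (e == coord t) = (index e (enum E) == t %% m)%N.
  rewrite /coord; apply/eqP/eqP => [->|<-]; last by rewrite nth_index ?mem_enum.
  by rewrite index_uniq ?enum_uniq // -cardE ltn_pmod.
rewrite /ver; move: (index e _) im => i im.
have tm := ltn_pmod t m0; have tE := divn_eq t m.
move: tm tE; set q := (t %/ m)%N; set s := (t %% m)%N => tm tE.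
have [sm|sm] := ltnP s.+1 m.
  have -> : (t.+1 %/ m = q)%N by rewrite tE -addnS divnMDl // divn_small // addn0.
  have -> : (t.+1 %% m = s.+1)%N by rewrite tE -addnS modnMDl modn_small.
  by rewrite ltnS leq_eqVlt; case: eqP => [->|_] /=; rewrite ?ltnn ?addn0 //;
    case: ltngtP.
(* Last step of a sweep: the quotient increases and the residue returns to 0. *)
have sE : s.+1 = m by apply/eqP; rewrite eqn_leq tm.
have -> : (t.+1 %/ m = q.+1)%N by rewrite tE -addnS sE -mulSnr mulnK.
have -> : (t.+1 %% m = 0)%N by rewrite tE -addnS sE -mulSnr modnMl.
by rewrite ltn0 addn0; move: im; rewrite -sE ltnS leq_eqVlt; case: ltngtP => //=;
  lia.
Qed.

Lemma ver_mono s t e : (s <= t)%N -> (ver s e <= ver t e)%N.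
Proof.
by elim: t => [|t IH]; rewrite leq_eqVlt => /predU1P[->//|//];
  rewrite ltnS ver_succ => /IH /leq_trans; apply; exact: leq_addr.
Qed.

Lemma ver_le l t e : (t <= l * m)%N -> (ver t e <= l)%N.
Proof.
by move=> /(@ver_mono _ _ e)/leq_trans; apply; rewrite /ver mulnK // modnMl addn0.
Qed.

Lemma ver_mul l e : ver (l * m) e = l.
Proof. by rewrite /ver mulnK // modnMl addn0. Qed.

Variable K : nat.
Implicit Type Y : {ffun 'I_K.+1 * E -> bool}.

(** At time [t] the path reads only version [ver t e] of each edge, so it is independent of later
    table entries. *)
Lemma ipath_upd Y t (i : 'I_K.+1) e b : (t <= K * m)%N ->
  (ver t e < i)%N -> ipath (upd Y (i, e) b) t = ipath Y t.
Proof.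
move=> tK ti; apply/ffunP => e'; rewrite !ffunE; case: eqP => // -[iE ee'].
by move: ti; rewrite -iE ee' inordK ?ltnn // ltnS; exact: ver_le.
Qed.

Lemma ipath_succ Y t :
  ipath Y t.+1 = upd (ipath Y t) (coord t) (ipath Y t.+1 (coord t)).
Proof.
apply/ffunP => e; rewrite !ffunE; case: eqP => [->//|/eqP ne].
by rewrite ver_succ (negPf ne) addn0.
Qed.

Lemma ipath_upd_succ Y t b : (t < K * m)%N ->
  ipath (upd Y (inord (ver t.+1 (coord t)), coord t) b) t.+1 =
  upd (ipath Y t) (coord t) b.
Proof.
move=> tK; set i := inord _; set c := coord t; set Y' := upd Y _ _.
have Yc : ipath Y' t.+1 c = b by rewrite /ipath ffunE upd_same.
rewrite ipath_succ Yc ipath_upd ?(ltnW tK) // /i inordK ?ltnS ?ver_le //.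
by rewrite ver_succ eqxx addn1.
Qed.

End Path.

(** * Safe walks and their entropy cost *)

Section Walk.
Variables (R : realType) (E : finType) (p : R).
Variable bad : E -> {ffun E -> bool} -> bool.
Hypotheses (p0 : 0 < p) (p1 : p < 1).
Hypothesis bad_upd : forall e A b, bad e (upd A e b) = bad e A.
Implicit Types (A : {ffun E -> bool}) (e : E) (g : {ffun E -> bool} -> R).

Let q0 : 0 < 1 - p. Proof. by rewrite subr_gt0. Qed.

(** Keeping the current value is always safe, so the survival probability stays positive. *)
Definition safe_step e A (y : bool) : bool := ~~ (bad e A && (y != A e)).

(** Averages over the refreshed bit [e], killing forbidden flips. Composed along the path, it gives
    the probability of a safe continuation from [A]. *)
Definition step_op e g A : R :=
  p * ((safe_step e A true)%:R * g (upd A e true)) +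
  (1 - p) * ((safe_step e A false)%:R * g (upd A e false)).

Definition bern_entropy (x : R) : R := - (x * ln x + (1 - x) * ln (1 - x)).

Lemma ln_conv (x y : R) : 0 < x -> 0 < y ->
  p * ln x + (1 - p) * ln y <= ln (p * x + (1 - p) * y).
Proof.
move=> x0 y0; set z := p * x + (1 - p) * y.
have z0 : 0 < z by rewrite addr_gt0 ?mulr_gt0.
have H (w : R) : 0 < w -> ln w <= ln z + (w / z - 1).
  move=> w0; have wz : 0 < w / z by rewrite divr_gt0.
  have {1}-> : w = z * (w / z) by rewrite [RHS]mulrC divfK ?gt_eqF.
  rewrite lnM ?posrE // lerD2l.
  have /le_ln1Dx : -1 < w / z - 1 by rewrite ltrBrDr addNr.
  by rewrite addrC subrK.
have := H x x0; have := H y y0 => Hy Hx.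
have : p * ln x + (1 - p) * ln y <=
   p * (ln z + (x / z - 1)) + (1 - p) * (ln z + (y / z - 1)).
  by rewrite lerD // ler_wpM2l // ltW.
move=> /le_trans; apply.
have -> : p * (ln z + (x / z - 1)) + (1 - p) * (ln z + (y / z - 1)) =
  ln z - 1 + z / z by rewrite /z; ring.
by rewrite divff ?gt_eqF // subrK.
Qed.

Lemma step_op_gt0 e g : (forall A, 0 < g A) -> forall A, 0 < step_op e g A.
Proof.
move=> g0 A; rewrite /step_op /safe_step.
have Ht := mulr_gt0 p0 (g0 (upd A e true)).
have Hf := mulr_gt0 q0 (g0 (upd A e false)).
by case: (bad e A); case: (A e) => /=;
  rewrite ?mul1r ?mul0r ?mulr0 ?addr0 ?add0r ?addr_gt0.
Qed.

(** Where [e] is bad only the current value survives, so the logarithm picks up [ln p] with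
    probability [p] and [ln (1 - p)] with probability [1 - p]: on average, minus the entropy.
    Elsewhere concavity of [ln] gives no loss. Since [bad e] ignores bit [e], both values fall in
    the same case. *)
Lemma pexp_ln_step_op e g : (forall A, 0 < g A) ->
  pexp p (fun A => ln (g A)) - bern_entropy p * pexp p (fun A => (bad e A)%:R)
  <= pexp p (fun A => ln (step_op e g A)).
Proof.
move=> g0; rewrite -mulNr -pexpZ [X in X + _ <= _](pexp_resample _ e) -pexpD.
rewrite [leRHS](pexp_resample _ e); apply: le_pexp => [||A]; try exact: ltW.
rewrite /step_op /safe_step !upd_upd !upd_same !bad_upd.
case: (bad e A) => /=.
  rewrite !mul1r !mul0r !mulr0 addr0 add0r mulr1.
  by rewrite !lnM ?posrE // /bern_entropy; lra.
rewrite !mul1r mulr0 addr0.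
have := ln_conv (g0 (upd A e true)) (g0 (upd A e false)).
set l := ln (p * _ + _); nra.
Qed.

(** Jensen passes to logarithms once for the whole walk; there the losses add, each step being
    measured under the same product law. *)
Lemma pexp_walk (es : seq E) :
  expR (- (bern_entropy p * \sum_(e <- es) pexp p (fun A => (bad e A)%:R))) <=
  pexp p (foldr step_op (fun _ => 1) es).
Proof.
have gt0 (s : seq E) A : 0 < foldr step_op (fun _ => 1) s A.
  by elim: s A => [|e s IH] A //=; exact: step_op_gt0.
apply: le_trans (expR_pexp_ln (ltW p0) (ltW p1) (gt0 es)).
rewrite ler_expR; elim: es => [|e es IH] /=.
  rewrite big_nil mulr0 oppr0.
  by apply: pexp_ge0 => [||A]; [exact: ltW|exact: ltW|rewrite ln1].
rewrite big_cons; apply: le_trans (pexp_ln_step_op e (gt0 es)).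
by move: IH; set s := \sum_(j <- _) _; lra.
Qed.

Variables (e0 : E) (K : nat).
Local Notation m := #|E|.
Local Notation coord := (coord e0).
Implicit Type Y : {ffun 'I_K.+1 * E -> bool}.

Lemma pexp_ipath t (F : {ffun E -> bool} -> R) :
  pexp p (fun Y => F (ipath Y t)) = pexp p F.
Proof.
rewrite -(@pexp_marginal _ _ _ p (fun e : E => (inord (ver t e) : 'I_K.+1, e)) F) //.
by move=> e e' [].
Qed.

Definition safe_path (t : nat) Y : bool :=
  [forall s : 'I_t, safe_step (coord s) (ipath Y s) (ipath Y s.+1 (coord s))].

Lemma safe_path_succ t Y : safe_path t.+1 Y =
  safe_path t Y && safe_step (coord t) (ipath Y t) (ipath Y t.+1 (coord t)).
Proof.
apply/forallP/andP => [H|[/forallP H Ht] s].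
  split; last exact: (H ord_max).
  by apply/forallP => s; exact: (H (widen_ord (leqnSn t) s)).
have [st|st] := ltnP s t; first exact: (H (Ordinal st)).
by have -> : nat_of_ord s = t by apply/eqP; rewrite eqn_leq st -ltnS ltn_ord.
Qed.

(** A martingale argument: safety so far times the probability of a safe continuation has constant
    mean in [t]. *)
Lemma pexp_safe_path_aux t : (t <= K * m)%N ->
  pexp p (fun Y => (safe_path t Y)%:R *
    foldr step_op (fun _ => 1) (drop t (mkseq coord (K * m))) (ipath Y t)) =
  pexp p (foldr step_op (fun _ => 1) (mkseq coord (K * m))).
Proof.
elim: t => [_|t IH tK].
  rewrite drop0 -[RHS](pexp_ipath 0); apply: eq_pexp => Y.
  have -> : safe_path 0 Y by apply/forallP => -[].
  by rewrite mul1r.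
transitivity (pexp p (fun Y => (safe_path t Y)%:R *
    foldr step_op (fun _ => 1) (drop t (mkseq coord (K * m))) (ipath Y t)));
  last exact: IH (ltnW tK).
(* Integrates out the bit used at step [t], which the path up to time [t] has not read. *)
rewrite [LHS](pexp_resample _ (inord (ver t.+1 (coord t)), coord t)).
rewrite (drop_nth e0 (n:=t)) ?size_mkseq // nth_mkseq //=.
set g := foldr _ _ _; apply: eq_pexp => Y; rewrite !safe_path_succ /step_op.
have vt b s : (s <= t)%N ->
    ipath (upd Y (inord (ver t.+1 (coord t)), coord t) b) s = ipath Y s.
  move=> st; rewrite (ipath_upd e0) //; first by rewrite (leq_trans st) // ltnW.
  rewrite inordK; last by rewrite ltnS (ver_le e0).
  by rewrite (ver_succ e0) eqxx addn1 ltnS (ver_mono e0).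
have spE b : safe_path t (upd Y (inord (ver t.+1 (coord t)), coord t) b) =
    safe_path t Y.
  apply: eq_forallb => s; rewrite !vt //; last by rewrite ltnW.
rewrite !spE !ipath_upd_succ // !vt // !upd_same.
by rewrite -!mulnb !natrM; ring.
Qed.

Lemma sum_coord (F : E -> R) :
  \sum_(e <- mkseq coord (K * m)) F e = K%:R * \sum_(e : E) F e.
Proof.
rewrite big_map; elim: (K) => [|k IH]; first by rewrite mul0n big_nil mul0r.
rewrite mulSnr iotaD big_cat IH -addn1 natrD mulrDl mul1r; congr (_ + _).
rewrite add0n -[X in iota X _]addn0 iotaDl big_map -[RHS]big_enum /=.
rewrite [RHS](big_nth e0) -cardE /index_iota subn0 big_seq [RHS]big_seq.
apply: eq_bigr => i; rewrite mem_iota add0n => /andP[_ im].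
by rewrite /coord modnMDl modn_small.
Qed.

(* Jensen's inequality along the path: the loss per step is the entropy of a bit. *)
Lemma pexp_safe_path :
  expR (- (bern_entropy p * (K%:R * \sum_e pexp p (fun A => (bad e A)%:R)))) <=
  pexp p (fun Y => (safe_path (K * m) Y)%:R).
Proof.
rewrite -sum_coord; apply: le_trans (pexp_walk _) _.
rewrite -(pexp_safe_path_aux (leqnn _)) drop_oversize ?size_mkseq //=.
by under eq_pexp do rewrite mulr1.
Qed.

End Walk.

(** * First moment bounds *)

Lemma exists_le_sum (R : realType) (T : finType) (P : pred T) :
  ([exists x, P x]%:R : R) <= \sum_(x | P x) 1.
Proof.
case: existsP => [[x Px]|_]; last exact: sumr_ge0.
by rewrite (bigD1 x) //= lerDl sumr_ge0.
Qed.

Lemma subset_card_exists (T : finType) (A : {set T}) (k : nat) : (k <= #|A|)%N ->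
  exists2 B : {set T}, B \subset A & #|B| == k.
Proof.
move=> kA; have : (0 < #|[set B : {set T} | B \subset A & #|B| == k]|)%N.
  by rewrite cards_draws bin_gt0.
by case/card_gt0P => B; rewrite inE => /andP[]; exists B.
Qed.

Section Hypergraph.
Variables (n r : nat).
Local Notation E := (redge n r).
Implicit Types (A : hgraph n r) (S M N U : {set 'I_n}) (e : E).

Definition indep A S : bool := [forall e : E, A e ==> ~~ (val e \subset S)].

Lemma indepS A S S' : S' \subset S -> indep A S -> indep A S'.
Proof.
move=> SS /forallP H; apply/forallP => e; apply/implyP => Ae.
by apply: contra (implyP (H e) Ae) => /fintype.subset_trans; exact.
Qed.

Lemma card_edges_in S : #|[set e : E | val e \subset S]%SET| = 'C(#|S|, r).
Proof.
rewrite -cards_draws -(card_imset _ (@val_inj _ _ (redge n r))).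
congr (#|pred_of_set _|); apply/setP => X; rewrite inE.
apply/imsetP/andP => [[e]|[XS Xr]].
  by rewrite inE => eS ->; split => //; exact: valP e.
by exists (Sub X Xr : E); rewrite ?inE SubK.
Qed.

Definition star M N : {set E} :=
  [set e : E | (#|val e :&: N|%SET == 1%N) && ((val e :\: N)%SET \subset M)]%SET.

Lemma star_sub M N e : e \in star M N -> val e \subset (M :|: N)%SET.
Proof.
rewrite inE => /andP[_ eM]; apply/fintype.subsetP => x xe.
rewrite finset.in_setU orbC; case: (boolP (x \in N)) => //= xN.
by apply: (fintype.subsetP eM); rewrite finset.in_setD xN.
Qed.

(** Star edges are not exposed by events about edges inside [U]. *)
Lemma star_meets M N U e : [disjoint N & U] -> e \in star M N ->
  ~~ (val e \subset U).
Proof.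
move=> NU; rewrite inE => /andP[/eqP e1 _]; apply/negP => eU.
have /card_gt0P[x] : (0 < #|val e :&: N|%SET)%N by rewrite e1.
case/setIP => /(fintype.subsetP eU) xU xN.
by move/pred0P: NU => /(_ x) /=; rewrite xU xN.
Qed.

(** Pairs of [x] in [N] and an [r.-1]-subset [G] of [M] inject into the star by [x |: G]: the
    intersection with [N] recovers [x]. *)
Lemma card_star M N : (0 < r)%N -> [disjoint N & M] ->
  (#|N| * 'C(#|M|, r.-1) <= #|star M N|)%N.
Proof.
move=> r0 NM; rewrite -cards_draws -cardsX.
have NMx x : x \in N -> x \in M = false.
  by move=> xN; move/pred0P: NM => /(_ x) /=; rewrite xN.
set X := finset.setX _ _.
have IN x G : (x, G) \in X -> ((x |: G) :&: N)%SET = [set x]%SET.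
  rewrite !inE /= => /and3P[xN GM _]; apply/setP => y; rewrite !inE.
  case: eqP => [->|_] /=; first by rewrite xN.
  apply/negP => /andP[/(fintype.subsetP GM) yM yN].
  by rewrite NMx in yM.
have inj : {in X &, injective (fun u : 'I_n * {set 'I_n} => u.1 |: u.2)%SET}.
  move=> [x G] [x' G'] H H' /= eq.
  have xx : x = x'.
    by apply: finset.set1_inj; rewrite -(IN _ _ H) -(IN _ _ H') eq.
  congr pair => //; move: eq H H'; rewrite -xx !inE /=.
  move=> eq /and3P[xN GM _] /and3P[_ GM' _].
  have xG : x \notin G by apply/negP => /(fintype.subsetP GM); rewrite NMx.
  have xG' : x \notin G' by apply/negP => /(fintype.subsetP GM'); rewrite NMx.
  by rewrite -(setU1K xG) eq setU1K.
rewrite -(card_in_imset inj) -(card_imset (star M N) (@val_inj _ _ (redge n r))).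
apply: subset_leq_card; apply/fintype.subsetP => Z /imsetP[[x G] H ->] /=.
move: (H); rewrite !inE /= => /and3P[xN GM /eqP Gr].
have xG : x \notin G by apply/negP => /(fintype.subsetP GM); rewrite NMx.
have Zr : #|(x |: G)%SET| == r by rewrite cardsU1 xG Gr add1n prednK.
apply/imsetP; exists (Sub (x |: G)%SET Zr : E); last by rewrite SubK.
rewrite inE SubK (IN _ _ H) cards1 eqxx /=.
apply/fintype.subsetP => y; rewrite !inE => /andP[yN /orP[/eqP yx|yG]].
  by rewrite yx xN in yN.
exact: (fintype.subsetP GM).
Qed.

Variables (R : realType) (p : R) (K a b : nat).
Hypotheses (p0 : 0 <= p) (p1 : p <= 1) (r0 : (0 < r)%N).
Local Notation m := #|{: E}|.
Local Notation Om := {ffun 'I_K.+1 * E -> bool}.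
Local Notation Move := ('I_(K * m).+1 * {set 'I_n} * {set 'I_n})%type.
Local Notation path Y t := (ipath Y t).
Implicit Type Y : Om.

Let q0 : 0 <= 1 - p. Proof. by rewrite subr_ge0. Qed.
Let q1 : 1 - p <= 1. Proof. by rewrite gerBl. Qed.

(** A move packs a time [x.1.1], a set [x.1.2] of old vertices and a set [x.2] of new ones. *)
Definition link Y U (x : Move) : bool :=
  [&& x.1.2 \subset U, #|x.1.2| == a, #|x.2| == b, [disjoint x.2 & U] &
      [forall e in star x.1.2 x.2, ~~ path Y x.1.1 e]].

(* The forbidden structure: from [U], [j] successive enlargements by [b] new
   vertices, such that at some time no edge joins one new vertex to [r - 1]
   vertices of some [a]-subset of the previous set. *)
Fixpoint chain Y (j : nat) U : bool :=
  if j is j'.+1 then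
    [exists x : Move,
       link Y U x && chain Y j' (U :|: x.2)%SET]
  else true.

(** Union bound for one link: a count of moves from a set of size at most [u], times a bound on the
    probability that all star edges are absent. *)
Definition link_rate (u : nat) : R :=
  ((K * m).+1 * 2 ^ u * 'C(n, b))%:R * (1 - p) ^+ (b * 'C(a, r.-1)).

Lemma link_rate_ge0 u : 0 <= link_rate u.
Proof. by rewrite mulr_ge0 ?exprn_ge0. Qed.

Lemma pexp_edges_absent (t : nat) (S : {set E}) (F : Om -> R) :
  (forall Y i e c, e \in S -> F (upd Y (i, e) c) = F Y) ->
  pexp p (fun Y => F Y * [forall e in S, ~~ path Y t e]%:R) =
  (1 - p) ^+ #|S| * pexp p F.
Proof.
move=> FS; pose h (e : E) : 'I_K.+1 * E := (inord (ver t e), e).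
have hinj : injective h by move=> e e' /(congr1 snd).
rewrite -(card_imset S hinj) -pexp_zero; last first.
  by move=> Y i c /imsetP[e eS ->]; exact: FS.
apply: eq_pexp => Y; congr (_ * (nat_of_bool _)%:R).
apply/forall_inP/forall_inP => H.
  by move=> i /imsetP[e eS ->]; have := H e eS; rewrite ffunE.
by move=> e eS; rewrite ffunE; apply: H; exact: imset_f.
Qed.

(** The weight [F] looks only at edges inside [U]. The star edges of a link leave [U] but lie in the
    enlarged set, so their absence is independent of [F] and is absorbed into the weight for the
    induction. *)
Lemma pexp_chain (u j : nat) U (F : Om -> R) : (forall Y, 0 <= F Y) ->
  (forall Y i e c, ~~ (val e \subset U) -> F (upd Y (i, e) c) = F Y) ->
  (#|U| + j * b <= u)%N ->
  pexp p (fun Y => F Y * (chain Y j U)%:R) <= link_rate u ^+ j * pexp p F.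
Proof.
elim: j U F => [|j IH] U F F0 FU Uu.
  by rewrite expr0 mul1r; apply: le_pexp => // Y; rewrite mulr1.
pose P (x : Move) :=
  [&& x.1.2 \subset U, #|x.1.2| == a, #|x.2| == b & [disjoint x.2 & U]].
pose G (x : Move) Y : R := F Y * [forall e in star x.1.2 x.2, ~~ path Y x.1.1 e]%:R.
apply: (@le_trans _ _ (\sum_(x | P x) pexp p (fun Y => G x Y *
    (chain Y j (U :|: x.2)%SET)%:R))).
  rewrite -pexp_sum; apply: le_pexp => // Y /=.
  apply: le_trans (ler_wpM2l (F0 Y) (exists_le_sum R _)) _.
  rewrite mulr_sumr [leRHS]big_mkcond [leLHS]big_mkcond; apply: ler_sum => x _.
  rewrite /G /link /P; set s := [forall e in _, _].
  case: (x.1.2 \subset U) => //=; case: (_ == a) => //=.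
  case: (_ == b) => //=; case: [disjoint _ & _] => //=.
  by case: s; case: (chain _ _ _); rewrite //= ?mulr1 ?mulr0.
have xP x : P x -> pexp p (fun Y => G x Y * (chain Y j (U :|: x.2)%SET)%:R) <=
    link_rate u ^+ j * ((1 - p) ^+ (b * 'C(a, r.-1)) * pexp p F).
  case/and4P => MU /eqP Ma /eqP Nb NU.
  apply: le_trans (IH _ _ _ _ _) _.
  - by move=> Y; rewrite mulr_ge0.
  - move=> Y i e c He; rewrite /G FU; last first.
      by apply: contra He => ?; apply: fintype.subset_trans (finset.subsetUl _ _).
    congr (_ * (nat_of_bool _)%:R); apply: eq_forallb => e'.
    case: (boolP (e' \in _)) => //= e'S; rewrite !ffunE.
    case: eqP => // /(congr1 snd) /= ee'; move: He; rewrite -ee'.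
    by rewrite (fintype.subset_trans (star_sub e'S)) // finset.setSU.
  - apply: leq_trans Uu; rewrite cardsU mulSn; lia.
  rewrite ler_wpM2l ?exprn_ge0 ?link_rate_ge0 //.
  rewrite pexp_edges_absent; last first.
    by move=> Y i e c eS; rewrite FU //; exact: star_meets eS.
  rewrite ler_wpM2r ?pexp_ge0 // ler_wiXn2l // -Ma -Nb card_star //.
  by apply: disjointWr NU.
apply: le_trans (ler_sum _ xP) _; rewrite sumr_const.
have cardP : (#|P| <= (K * m).+1 * 2 ^ u * 'C(n, b))%N.
  apply: (@leq_trans (#|[set: 'I_(K * m).+1]%SET| * #|powerset U| *
     #|[set N : {set 'I_n} | #|N| == b]%SET|)).
    rewrite -!cardsX; apply: subset_leq_card; apply/fintype.subsetP => -[[t M] N].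
    by rewrite !inE /= => /and4P[-> _ -> _].
  rewrite cardsT card_ord card_draws card_ord leq_mul2r leq_mul2l card_powerset.
  by rewrite leq_exp2l // (leq_trans _ Uu) ?leq_addr ?orbT.
rewrite -mulr_natl exprSr -!mulrA mulrCA ler_wpM2l ?exprn_ge0 ?link_rate_ge0 //.
by rewrite !mulrA !ler_wpM2r ?pexp_ge0 ?exprn_ge0 // ler_nat.
Qed.

Lemma pexp_some_chain (u : nat) : (a + K * b <= u)%N ->
  pexp p (fun Y => [exists S : {set 'I_n}, (#|S| == a) && chain Y K S]%:R) <=
  'C(n, a)%:R * link_rate u ^+ K.
Proof.
move=> au.
apply: (@le_trans _ _ (\sum_(S : {set 'I_n} | #|S| == a)
   pexp p (fun Y => 1 * (chain Y K S)%:R))).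
  rewrite -pexp_sum; apply: le_pexp => // Y.
  apply: le_trans (exists_le_sum R _) _.
  rewrite [leRHS]big_mkcond [leLHS]big_mkcond; apply: ler_sum => S _.
  by case: (_ == a); case: chain; rewrite //= ?mulr1 ?mulr0.
apply: (@le_trans _ _ (\sum_(S : {set 'I_n} | #|S| == a) link_rate u ^+ K)).
  apply: ler_sum => S /eqP Sa.
  have := @pexp_chain u K S (fun=> 1) (fun=> ler01) (fun _ _ _ _ _ => erefl).
  by rewrite Sa pexp1 mulr1; exact.
rewrite sumr_const mulr_natl.
suff -> : #|[pred S : {set 'I_n} | #|S| == a]| = 'C(n, a) by [].
by rewrite -[in RHS](card_ord n) -card_draws cardsE.
Qed.

(** At time [l.+1 * m] every edge has version [l.+1], which [U] does not read. Hence a union bound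
    over at most [2 ^ u] sets [M], each requiring ['C(a, r)] absent edges. *)
Lemma pexp_fresh (u l : nat) (U : Om -> {set 'I_n}) : (l < K)%N ->
  (forall Y, (#|U Y| <= u)%N) ->
  (forall Y e c, U (upd Y (inord l.+1, e) c) = U Y) ->
  pexp p (fun Y => [exists M : {set 'I_n}, [&& M \subset U Y, #|M| == a &
     indep (path Y (l.+1 * m)) M]]%:R) <= (2 ^ u)%:R * (1 - p) ^+ 'C(a, r).
Proof.
move=> lK Uu Uinv.
pose eds M := [set e : E | val e \subset M]%SET.
apply: (@le_trans _ _ (\sum_(M : {set 'I_n}) pexp p (fun Y =>
    ((M \subset U Y) && (#|M| == a))%:R *
    [forall i in (pair (inord l.+1 : 'I_K.+1) @: eds M)%SET, ~~ Y i]%:R))).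
  rewrite -pexp_sum; apply: le_pexp => // Y.
  apply: le_trans (exists_le_sum R _) _.
  rewrite big_mkcond; apply: ler_sum => M _.
  case: (M \subset U Y) => /=; last by rewrite mul0r.
  case: (#|M| == a) => /=; last by rewrite mul0r.
  rewrite mul1r; case: ifP => // /forallP ind.
  suff -> : [forall i in (pair (inord l.+1 : 'I_K.+1) @: eds M)%SET, ~~ Y i] by [].
  apply/forall_inP => i /imsetP[e]; rewrite inE => eM ->.
  have := implyP (ind e); rewrite ffunE (ver_mul e).
  by case: (Y _) => //= /(_ isT); rewrite eM.
have pinj (x : 'I_K.+1) : injective (pair x : E -> _).
  by move=> e e' /(congr1 snd).
apply: (@le_trans _ _ (\sum_(M : {set 'I_n}) pexp p (fun Y =>
    ((M \subset U Y) && (#|M| == a))%:R * (1 - p) ^+ 'C(a, r)))).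
  apply: ler_sum => M _; rewrite pexp_zero; last first.
    by move=> Y i c /imsetP[e _ ->]; rewrite Uinv.
  rewrite card_imset // card_edges_in.
  have [Ma|Ma] := eqVneq #|M| a.
    by rewrite Ma -pexpZ; apply: le_pexp => // Y; rewrite mulrC.
  rewrite -pexpZ; apply: le_pexp => // Y.
  by rewrite andbF mulr0 mul0r.
rewrite -pexp_sum -[leRHS](pexp_cst [the finType of ('I_K.+1 * E)%type] p).
apply: le_pexp => // Y.
rewrite -mulr_suml ler_wpM2r ?exprn_ge0 // -natr_sum ler_nat.
apply: (@leq_trans #|powerset (U Y)|); last first.
  by rewrite card_powerset leq_exp2l.
rewrite -sum1_card [leqRHS]big_mkcond leq_sum // => M _.
by rewrite inE; case: (_ \subset _); case: (_ == a).
Qed.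

End Hypergraph.

(** * Greedy construction of the forbidden structure *)

(** A failed search returns [N], where [P] holds by hypothesis. *)
Lemma find_iota (P : pred nat) (N : nat) : P N ->
  let s := find P (iota 0 N) in
  [/\ (s <= N)%N, P s & forall j, (j < s)%N -> ~~ P j].
Proof.
move=> PN s; have sN : (s <= N)%N by rewrite -[leqRHS](size_iota 0 N) find_size.
split=> // [|j js].
  have [sN'|Ns] := ltnP s N; last by have -> : s = N by apply/eqP; rewrite eqn_leq sN.
  have : has P (iota 0 N) by rewrite has_find size_iota.
  by move=> /(nth_find 0%N); rewrite nth_iota.
have /negbT := before_find 0%N js.
by rewrite nth_iota ?add0n // (leq_trans js).
Qed.

Section Greedy.
Variables (n r K a b k : nat) (V : hgraph n r -> {set 'I_n}).
Local Notation E := (redge n r).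
Local Notation m := #|{: E}|.
Local Notation path Y t := (ipath Y t).
Implicit Types (Y : {ffun 'I_K.+1 * E -> bool}) (X U : {set 'I_n}).

(** A canonical choice, making the greedy construction a function of the path. *)
Definition pick_sub (c : nat) X : {set 'I_n} := [set x in take c (enum X)]%SET.

Lemma pick_sub_sub c X : pick_sub c X \subset X.
Proof.
by apply/fintype.subsetP => x; rewrite inE => /mem_take; rewrite mem_enum.
Qed.

Lemma card_pick_sub c X : #|pick_sub c X| = minn c #|X|.
Proof.
rewrite cardsE (card_uniqP _) ?take_uniq ?enum_uniq // size_take_min.
by rewrite -cardE.
Qed.

(** Holds the current set and time. The search runs up to time [l'.+1 * m], which is also the
    default when it fails. *)
Fixpoint stage Y (l : nat) : {set 'I_n} * nat :=
  if l is l'.+1 then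
    let U := (stage Y l').1 in
    let t := (stage Y l').2 in
    let s := find (fun s => b <= #|V (path Y (t + s)) :\: U|)%N
                  (iota 0 (l'.+1 * m - t)) in
    ((U :|: pick_sub b (V (path Y (t + s)) :\: U))%SET, (t + s)%N)
  else (pick_sub a (V (path Y 0)), 0%N).

Lemma stage_time Y l : ((stage Y l).2 <= l * m)%N.
Proof.
elim: l => //= l IH; set P := (fun s => _ <= _)%N.
have := find_size P (iota 0 (l.+1 * m - (stage Y l).2)).
by rewrite size_iota leq_subRL // (leq_trans IH) // mulSn leq_addl.
Qed.

Lemma card_stage Y l : (#|(stage Y l).1| <= a + l * b)%N.
Proof.
elim: l => /= [|l IH]; first by rewrite card_pick_sub addn0 geq_minl.
apply: leq_trans (leq_card_setU _ _) _; rewrite card_pick_sub [in leqRHS]mulSnr addnA.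
by apply: leq_add IH _; exact: geq_minl.
Qed.

(** Stage [l] reads the path up to time [l * m], hence versions up to [l] only: this is the
    independence needed by [pexp_fresh]. *)
Lemma stage_upd Y l (i : 'I_K.+1) e c : (l < i)%N ->
  stage (upd Y (i, e) c) l = stage Y l.
Proof.
have pathE l' t : (l' < i)%N -> (t <= l' * m)%N ->
    ipath (upd Y (i, e) c) t = ipath Y t.
  move=> li tl; apply: (ipath_upd e).
    by rewrite (leq_trans tl) // leq_mul2r -ltnS (ltn_trans li) ?orbT.
  by apply: leq_ltn_trans li; exact: (ver_le e).
elim: l => [|l IH] li /=; first by rewrite (pathE 0%N).
rewrite IH; last by rewrite ltnW.
have tl := stage_time Y l.
set t := (stage Y l).2 in tl *; set U := (stage Y l).1.
have lm : (t <= l.+1 * m)%N by rewrite (leq_trans tl) // mulSn leq_addl.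
have -> : find (fun s => b <= #|V (path (upd Y (i, e) c) (t + s)) :\: U|)%N
               (iota 0 (l.+1 * m - t)) =
          find (fun s => b <= #|V (path Y (t + s)) :\: U|)%N
               (iota 0 (l.+1 * m - t)).
  apply: eq_in_find => s; rewrite mem_iota add0n => /andP[_ sm].
  by rewrite (pathE l.+1) // -leq_subRL ?(ltnW sm).
rewrite (pathE l.+1) //; set P := (fun s => _ <= _)%N.
have := find_size P (iota 0 (l.+1 * m - t)); by rewrite size_iota leq_subRL.
Qed.

Hypothesis Vindep : forall A, indep A (V A).
Hypothesis abk : (a + 2 * b <= k)%N.
Variable Y : {ffun 'I_K.+1 * E -> bool}.
Hypothesis Vstep : forall t, (t < K * m)%N ->
  (#|V (path Y t.+1) :\: V (path Y t)| <= b)%N.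
Hypothesis Vbig : forall t, (t <= K * m)%N -> (k <= #|V (path Y t)|)%N.
Hypothesis Vfresh : forall l, (l < K)%N ->
  ~~ [exists M : {set 'I_n}, [&& M \subset (stage Y l).1, #|M| == a &
       indep (path Y (l.+1 * m)) M]].

Let overlap l := (a <= #|V (path Y (stage Y l).2) :&: (stage Y l).1|)%N.

(** At time [l.+1 * m] fewer than [a] vertices of the rounded set lie in [U], so at least [b] lie
    outside and the wait ends. One step before it ends, fewer than [b] were outside; a step adds at
    most [b], so fewer than [2 * b] are outside and at least [a] remain inside. *)
Lemma stage_step l : (l < K)%N -> overlap l ->
  (b <= #|V (path Y (stage Y l.+1).2) :\: (stage Y l).1|)%N /\
  (a <= #|V (path Y (stage Y l.+1).2) :&: (stage Y l).1|)%N.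
Proof.
rewrite /overlap /= => lK; have tl := stage_time Y l.
have := Vfresh lK; set t := (stage Y l).2 in tl *; set U := (stage Y l).1.
move=> fresh ov; set N := (l.+1 * m - t)%N.
have lmK : (l.+1 * m <= K * m)%N by rewrite leq_mul2r lK orbT.
have tN : (t + N = l.+1 * m)%N.
  by rewrite subnKC // (leq_trans tl) // mulSn leq_addl.
have PN : (b <= #|V (path Y (t + N)) :\: U|)%N.
  rewrite tN; have := Vbig lmK; rewrite -(cardsID U).
  have : (#|V (path Y (l.+1 * m)) :&: U| < a)%N.
    rewrite ltnNge; apply: contra fresh => /subset_card_exists[M MVU Ma].
    move: MVU; rewrite finset.subsetI => /andP[MV MU].
    by apply/existsP; exists M; rewrite MU Ma (indepS MV).
  by move: abk #|_ :&: _|%SET #|_ :\: _|%SET; clear; lia.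
have := @find_iota (fun s => b <= #|V (path Y (t + s)) :\: U|)%N N PN.
move: (find _ _) => s /= [sN Ps Pmin]; split=> //.
(* Without waiting, the assumed overlap at the current time is the claim. *)
case: s sN Ps Pmin => [|s'] sN Ps Pmin; first by rewrite addn0.
have := Pmin s' (ltnSn s'); rewrite -ltnNge => small.
have tsK : (t + s' < K * m)%N by rewrite (leq_trans _ lmK) // -addnS -tN leq_add2l.
have step := @Vstep (t + s')%N tsK.
have big := @Vbig (t + s').+1 tsK.
rewrite addnS; move: big; rewrite -(cardsID U).
have : (#|V (path Y (t + s').+1) :\: U| <=
   #|V (path Y (t + s')) :\: U| + #|V (path Y (t + s').+1) :\: V (path Y (t + s'))|)%N.
  apply: leq_trans (leq_card_setU _ _); apply: subset_leq_card.
  apply/fintype.subsetP => x; rewrite !inE.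
  by case: (x \in U); case: (x \in V (path Y (t + s'))).
move: small step abk.
move: #|V (path Y (t + s').+1) :&: U|%SET #|V (path Y (t + s').+1) :\: U|%SET.
move: #|V (path Y (t + s')) :\: U|%SET #|_ :\: _|%SET.
by clear; lia.
Qed.

Lemma stage_link l : (l < K)%N -> overlap l -> overlap l.+1 /\
  exists x, link a b Y (stage Y l).1 x /\ ((stage Y l).1 :|: x.2)%SET = (stage Y l.+1).1.
Proof.
move=> lK ov; have [Nb Ma] := stage_step lK ov.
have tK : ((stage Y l.+1).2 <= K * m)%N.
  by rewrite (leq_trans (stage_time Y _)) // leq_mul2r lK orbT.
split.
  apply: leq_trans Ma _; apply: subset_leq_card; apply: finset.setIS => /=.
  exact: finset.subsetUl.
have [M] := subset_card_exists Ma; rewrite finset.subsetI => /andP[MV MU] Ma'.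
set t' := (stage Y l.+1).2 in tK MV Nb *.
set N := pick_sub b (V (path Y t') :\: (stage Y l).1).
exists (inord t', M, N); split => //.
rewrite /link /= MU Ma' card_pick_sub (minn_idPl Nb) eqxx /= inordK ?ltnS //.
have NV := pick_sub_sub b (V (path Y t') :\: (stage Y l).1).
apply/andP; split.
  apply/pred0P => x /=; apply/negP => /andP[/(fintype.subsetP NV)].
  by rewrite finset.in_setD => /andP[/negPf ->].
(* [M] and [N] both lie in the independent set [V (path Y t')], so no star edge is present. *)
apply/forall_inP => e /star_sub eMN.
have /forallP/(_ e) := Vindep (path Y t'); apply: contraL => -> /=.
rewrite negbK (fintype.subset_trans eMN) // finset.subUset MV /=.
by apply: fintype.subset_trans NV _; exact: finset.subsetDl.
Qed.

Lemma greedy_chain : [exists S : {set 'I_n}, (#|S| == a) && chain a b Y K S].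
Proof.
have ov l : (l <= K)%N -> overlap l.
  elim: l => [_|l IH lK]; last by have [] := stage_link lK (IH (ltnW lK)).
  rewrite /overlap /= (finset.setIidPr _) ?pick_sub_sub // card_pick_sub.
  by rewrite leq_min leqnn (leq_trans _ (Vbig (leq0n _))) // (leq_trans _ abk) ?leq_addr.
apply/existsP; exists (stage Y 0).1; apply/andP; split.
  rewrite /= card_pick_sub; apply/eqP/minn_idPl.
  by rewrite (leq_trans _ (Vbig (leq0n _))) // (leq_trans _ abk) ?leq_addr.
suff H j l : (l + j = K)%N -> chain a b Y j (stage Y l).1 by exact: H.
elim: j l => //= j IH l lj.
have lK : (l < K)%N by lia.
have [_ [x [xl xE]]] := stage_link lK (ov _ (ltnW lK)).
by apply/existsP; exists x; rewrite xl xE IH // addSnnS.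
Qed.

End Greedy.

(** * Deterministic maps *)

(** A new vertex has [y i >= 1], so it was removed from [Iset x], was in [Jset x], or moved by at
    least 1/2. As the old rounding is nonempty it succeeded, so the first two kinds number at most
    [eta * n]; the distance bound leaves at most [4 * c * n] of the third. *)
Lemma Vround_stable (R : realType) (n r : nat) (eta c : R) (A B : hgraph n r)
    (x y : 'I_n -> R) :
  (0 < #|Vround eta A x|)%N -> \sum_i (y i - x i) ^+ 2 <= c * n%:R ->
  #|(Vround eta B y :\: Vround eta A x)%SET|%:R <= (eta + 4 * c) * n%:R.
Proof.
rewrite {1 3}/Vround; case: ifP => [small _ dist|]; last by rewrite cards0.
pose Z := [set i | (1 <= y i) && (x i <= 1 / 2)]%SET.
have Zle : #|Z|%:R <= 4 * c * n%:R.
  have : #|Z|%:R * (4^-1 : R) <= \sum_i (y i - x i) ^+ 2.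
    rewrite mulr_natl -sumr_const big_mkcond; apply: ler_sum => i _.
    case: ifP => [|_]; last exact: sqr_ge0.
    by rewrite inE => /andP[y1 x1]; nra.
  by move: dist; lra.
have sub : (Vround eta B y :\: Itil A x)%SET \subset
    ((Iset x :\: Itil A x) :|: Jset x :|: Z)%SET.
  apply/fintype.subsetP => i; rewrite !inE => /andP[iA iB].
  have yi : 1 <= y i.
    move: iB; rewrite /Vround; case: ifP => _; last by rewrite inE.
    by rewrite !inE => /andP[].
  rewrite iA yi /=; case: (leP 1 (x i)) => //= x1.
  by case: (leP (x i) (1 / 2)); rewrite ?orbT.
have : (#|(Vround eta B y :\: Itil A x)%SET| <=
    #|(Iset x :\: Itil A x)%SET| + #|Jset x| + #|Z|)%N.
  apply: leq_trans (subset_leq_card sub) _.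
  by apply: leq_trans (leq_card_setU _ _) _; rewrite leq_add2r leq_card_setU.
rewrite -(ler_nat R) !natrD => /le_trans; apply.
by move: small; rewrite natrD; lra.
Qed.

Lemma Vround_indep (R : realType) (n r : nat) (eta : R) (A : hgraph n r)
    (x : 'I_n -> R) : (0 < r)%N -> indep A (Vround eta A x).
Proof.
move=> r0; apply/forallP => e; apply/implyP => Ae; apply/negP.
have /card_gt0P[i ie] : (0 < #|val e|)%N by rewrite (eqP (valP e)).
rewrite /Vround; case: ifP => [_|_] eV.
  have eI : val e \subset Iset x.
    by apply: fintype.subset_trans eV _; apply/fintype.subsetP => j; rewrite inE => /andP[].
  have := fintype.subsetP eV i ie; rewrite inE => /andP[_ /existsP[]].
  by exists e; rewrite Ae ie eI.
by have := fintype.subsetP eV i ie; rewrite inE.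
Qed.

(** The numerical hypothesis makes a safe path likelier than all failures together, so some table
    [Y] is safe and free of failures. The greedy construction then yields a chain, itself one of the
    failures. *)
Lemma no_optimizing_map (R : realType) (n r : nat) (p eta c s tau : R)
    (K a b k u D : nat) (g : hgraph n r -> 'I_n -> R) (e0 : redge n r) :
  0 < p -> p < 1 -> 0 < c -> (0 < n)%N -> (0 < r)%N -> (0 < k)%N ->
  (forall i, low_degree p D (fun A => g A i)) ->
  pexp p (fun A => \sum_i g A i ^+ 2) <= s ->
  pexp p (fun A => (#|Vround eta A (g A)| < k)%N%:R) <= tau ->
  (eta + 4 * c) * n%:R <= b%:R -> (a + 2 * b <= k)%N -> (a + K * b <= u)%N ->
  0 <= bern_entropy p ->
  (K * #|{: redge n r}|).+1%:R * tau
   + ('C(n, a)%:R * link_rate n r p K a b u ^+ K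
      + K%:R * ((2 ^ u)%:R * (1 - p) ^+ 'C(a, r)))
   < expR (- (bern_entropy p * (K%:R * (D%:R * s / (p * (1 - p) * (c * n%:R)))))) ->
  False.
Proof.
move=> p0 p1 c0 n0 r0 k0 gD gs gtau etab abk au h0 num.
have q0 : 0 < 1 - p by rewrite subr_gt0.
have p0' := ltW p0; have p1' := ltW p1.
have cn0 : 0 < c * n%:R by rewrite mulr_gt0 ?ltr0n.
pose V A := Vround eta A (g A).
pose dist e A := \sum_i (g (upd A e true) i - g (upd A e false) i) ^+ 2.
pose bad e A := c * n%:R < dist e A.
have bad_upd e A y : bad e (upd A e y) = bad e A.
  by rewrite /bad /dist; under eq_bigr do rewrite !upd_upd.
have flip_sqr (X : bool -> R) (y z : bool) : y != z ->
    (X y - X z) ^+ 2 = (X true - X false) ^+ 2.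
  by case: y; case: z => // _; rewrite -sqrrN opprB.
have dE A e y : \sum_i (g (upd A e y) i - g A i) ^+ 2 =
    if y == A e then 0 else dist e A.
  case: eqP => [->|/eqP yA].
    by rewrite upd_id big1 // => i _; rewrite subrr expr0n.
  apply: eq_bigr => i _; rewrite -{2}(upd_id A e).
  exact: (flip_sqr (fun z => g (upd A e z) i)).
(* Markov's inequality on the squared jump, then the influence bound summed over output
   coordinates. *)
have sum_bad : \sum_e pexp p (fun A => (bad e A)%:R) <=
    D%:R * s / (p * (1 - p) * (c * n%:R)).
  rewrite ler_pdivlMr ?mulr_gt0 ?ltr0n //.
  apply: (@le_trans _ _ (\sum_i p * (1 - p) *
     \sum_e pexp p (fun A => (g (upd A e true) i - g (upd A e false) i) ^+ 2))).
    rewrite -mulr_sumr [in leRHS]exchange_big /= [leLHS]mulrCA ler_wpM2l ?mulr_ge0 ?(ltW q0) //.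
    rewrite mulr_suml; apply: ler_sum => e _.
    rewrite -pexp_sum mulrC -pexpZ; apply: le_pexp => // A.
    rewrite -/(dist e A) /bad; case: ltP => [/ltW|_]; first by rewrite mulr1.
    by rewrite mulr0 sumr_ge0 // => i _; exact: sqr_ge0.
  apply: (@le_trans _ _ (\sum_i D%:R * pexp p (fun A => g A i ^+ 2))).
    by apply: ler_sum => i _; apply: total_influence.
  by rewrite -mulr_sumr -pexp_sum ler_wpM2l.
have lb : expR (- (bern_entropy p * (K%:R * (D%:R * s / (p * (1 - p) * (c * n%:R)))))) <=
    pexp p (fun Y : {ffun 'I_K.+1 * redge n r -> bool} =>
      (safe_path bad e0 (K * #|{: redge n r}|) Y)%:R).
  apply: le_trans (pexp_safe_path p0 p1 bad_upd e0 K).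
  by rewrite ler_expR lerN2 ler_wpM2l // ler_wpM2l.
(* Counts the times with a small rounded set, the existence of a chain, and the sweeps whose fresh
   hypergraph has an independent [a]-subset of the stage. *)
pose fails (Y : {ffun 'I_K.+1 * redge n r -> bool}) : R :=
  \sum_(t < (K * #|{: redge n r}|).+1) (#|V (ipath Y t)| < k)%N%:R +
  ([exists S : {set 'I_n}, (#|S| == a) && chain a b Y K S]%:R +
   \sum_(l < K) [exists M : {set 'I_n}, [&& M \subset (stage a b V Y l).1,
      #|M| == a & indep (ipath Y (l.+1 * #|{: redge n r}|)) M]]%:R).
have : pexp p fails < pexp p (fun Y : {ffun 'I_K.+1 * redge n r -> bool} =>
      (safe_path bad e0 (K * #|{: redge n r}|) Y)%:R).
  apply: le_lt_trans (lt_le_trans num lb); rewrite /fails !pexpD !pexp_sum.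
  apply: lerD.
    rewrite -[X in X%:R * _](card_ord (K * #|{: redge n r}|).+1).
    rewrite mulr_natl -sumr_const; apply: ler_sum => t _.
    by rewrite (pexp_ipath p _ _ (fun A => (#|V A| < k)%N%:R)).
  apply: lerD; first exact: pexp_some_chain.
  rewrite -[X in X%:R * _](card_ord K) mulr_natl -sumr_const; apply: ler_sum => l _.
  apply: pexp_fresh => //.
    move=> Y; apply: leq_trans (card_stage _ _ _ _ _) _; apply: leq_trans au.
    by rewrite leq_add2l leq_mul2r ltnW ?orbT.
  by move=> Y e y; rewrite stage_upd // inordK // ltnS.
case/(pexp_gt_exists p0' p1') => Y.
case sY : (safe_path _ _ _ _) => /=; last first.
  by rewrite ltNge /fails !addr_ge0 ?sumr_ge0.
move=> fY; have {}fY : ~~ (1 <= fails Y) by rewrite -ltNge.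
have Vbig t : (t <= K * #|{: redge n r}|)%N -> (k <= #|V (ipath Y t)|)%N.
  move=> tK; rewrite leqNgt; apply/negP => bad_t; move: fY.
  apply/negP; rewrite negbK /fails (bigD1 (inord t)) //= inordK // bad_t /= mulr1n.
  by rewrite -!addrA lerDl !addr_ge0 ?sumr_ge0.
have fresh l : (l < K)%N ->
    ~~ [exists M : {set 'I_n}, [&& M \subset (stage a b V Y l).1,
      #|M| == a & indep (ipath Y (l.+1 * #|{: redge n r}|)) M]].
  move=> lK; apply/negP => H; move: fY.
  apply/negP; rewrite negbK /fails [X in _ + (_ + X)](bigD1 (Ordinal lK)) //= H /= mulr1n.
  by rewrite addrA addrCA lerDl !addr_ge0 ?sumr_ge0.
suff Hch : [exists S : {set 'I_n}, (#|S| == a) && chain a b Y K S].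
  move: fY; apply/negP; rewrite negbK /fails Hch /= mulr1n addrCA.
  by rewrite lerDl !addr_ge0 ?sumr_ge0.
apply: (@greedy_chain n r K a b k V) => //.
  by move=> A; exact: Vround_indep.
move=> t tK; rewrite -(ler_nat R); apply: le_trans etab.
apply: Vround_stable.
  by apply: leq_trans (Vbig t (ltnW tK)).
move/forallP: sY => /(_ (Ordinal tK)); rewrite /safe_step /= (ipath_succ e0).
rewrite dE upd_same; case: (_ == _) => /=; first by rewrite andbF ltW.
by rewrite andbT /bad -leNgt.
Qed.

(** * Fixing the internal randomness *)

Section Sampling.
Variables (R : realType) (dT : measure_display) (T : measurableType dT).
Variable P : probability T R.
Local Open Scope ereal_scope.

Lemma measurable_finite_code (S : finType) (h : T -> S) (good : pred S) :
  (forall s, measurable [set w | h w = s]%classic) ->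
  measurable [set w | good (h w)]%classic.
Proof.
move=> mh.
have -> : [set w | good (h w)]%classic =
    (\bigcup_(s in [set s | good s]) [set w | h w = s])%classic.
  by apply/seteqP; split => w /= => [gw|[s gs ->]] //; exists (h w).
by apply: fin_bigcup_measurable => //; exact: finite_finset.
Qed.

(** If every [w] violated one bound, [f1 / (3 * x) + f2 / (3 * y)] would be at least 1 everywhere,
    while its integral is at most 2/3. *)
Lemma exists_both_small (f1 f2 : T -> R) (x y : R) :
  (0 < x)%R -> (0 < y)%R ->
  (forall w, 0 <= f1 w)%R -> (forall w, 0 <= f2 w)%R ->
  measurable_fun setT f1 -> measurable_fun setT f2 ->
  \int[P]_w (f1 w)%:E <= x%:E -> \int[P]_w (f2 w)%:E <= y%:E ->
  exists w, (f1 w <= 3 * x)%R /\ (f2 w <= 3 * y)%R.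
Proof.
move=> x0 y0 f10 f20 mf1 mf2 I1 I2; apply: contrapT => H.
have x3 : (0 <= (3 * x)^-1)%R by rewrite invr_ge0; lra.
have y3 : (0 <= (3 * y)^-1)%R by rewrite invr_ge0; lra.
have low w : (1 <= (3 * x)^-1 * f1 w + (3 * y)^-1 * f2 w)%R.
  rewrite leNgt; apply/negP => lt1; apply: H; exists w.
  have g1 : (0 <= (3 * x)^-1 * f1 w)%R by rewrite mulr_ge0.
  have g2 : (0 <= (3 * y)^-1 * f2 w)%R by rewrite mulr_ge0.
  split; rewrite -[leRHS]mulr1 -ler_pdivrMl; try lra.
have mE1 : measurable_fun setT (EFin \o f1) by exact/measurable_EFinP.
have mE2 : measurable_fun setT (EFin \o f2) by exact/measurable_EFinP.
have mZ (c : R) (f : T -> R) : measurable_fun setT f ->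
    measurable_fun setT (EFin \o (fun w => c * f w)%R).
  by move=> mf; apply/measurable_EFinP; exact: measurable_funM.
have one : \int[P]_w 1%:E = 1%:E.
  have := integral_cst P measurableT 1%:E.
  by rewrite [X in _ * X](_ : _ = 1) ?mule1 //; exact: probability_setT.
have : \int[P]_w 1%:E <= \int[P]_w (((3 * x)^-1)%:E * (f1 w)%:E + ((3 * y)^-1)%:E * (f2 w)%:E).
  apply: ge0_le_integral => //.
  - by apply: emeasurable_funD; exact: mZ.
  - by move=> w _; rewrite -!EFinM -EFinD lee_fin.
rewrite one ge0_integralD //; first last.
- exact: mZ.
- by move=> w _; rewrite -EFinM lee_fin mulr_ge0.
- exact: mZ.
- by move=> w _; rewrite -EFinM lee_fin mulr_ge0.
rewrite !ge0_integralZl_EFin //; try by move=> w _; rewrite lee_fin.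
have J1 : ((3 * x)^-1)%:E * \int[P]_w (f1 w)%:E <= (3^-1)%:E.
  apply: (le_trans (lee_wpmul2l _ I1)); first by rewrite lee_fin.
  by rewrite -EFinM lee_fin invfM -mulrA mulVf ?mulr1 ?gt_eqF.
have J2 : ((3 * y)^-1)%:E * \int[P]_w (f2 w)%:E <= (3^-1)%:E.
  apply: (le_trans (lee_wpmul2l _ I2)); first by rewrite lee_fin.
  by rewrite -EFinM lee_fin invfM -mulrA mulVf ?mulr1 ?gt_eqF.
by move=> /le_trans /(_ (leeD J1 J2)); rewrite -EFinD lee_fin; lra.
Qed.

Lemma integral_pexp (I : finType) (p : R) (F : {ffun I -> bool} -> T -> R) :
  (0 <= p <= 1)%R ->
  (forall Y w, 0 <= F Y w)%R -> (forall Y, measurable_fun setT (F Y)) ->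
  measurable_fun setT (fun w => pexp p (fun Y => F Y w)) /\
  \int[P]_w (pexp p (fun Y => F Y w))%:E =
  \sum_(Y : {ffun I -> bool}) (\prod_(i : I) (if Y i then p else 1 - p))%R%:E *
     \int[P]_w (F Y w)%:E.
Proof.
move=> /andP[p0 p1] F0 mF; split.
  by apply: measurable_sum => Y; exact: measurable_funM.
have w0 (Y : {ffun I -> bool}) : (0 <= \prod_(i : I) (if Y i then p else 1 - p))%R.
  by apply: prodr_ge0 => i _; case: ifP => _ //; rewrite subr_ge0.
under eq_integral => w _ do rewrite /pexp -sumEFin.
rewrite ge0_integral_sum //.
- apply: eq_bigr => Y _; rewrite -ge0_integralZl_EFin //.
  + by move=> w _; rewrite lee_fin.
  + exact/measurable_EFinP.
- by move=> Y; apply/measurable_EFinP; exact: measurable_funM.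
- by move=> Y w _; rewrite lee_fin mulr_ge0.
Qed.

End Sampling.

Lemma measurable_Vround (R : realType) (n r k : nat) (eta : R) (A : hgraph n r)
    (dT : measure_display) (T : measurableType dT) (x : T -> 'I_n -> R) :
  (forall i, measurable_fun setT (fun w => x w i)) ->
  measurable [set w | (k <= #|Vround eta A (x w)|)%N]%classic.
Proof.
move=> mx.
pose h w : {ffun 'I_n -> bool * bool} := [ffun i => (1 <= x w i, 1 / 2 < x w i)].
(* [Vround] sees [x] only through the two threshold comparisons in [h], so [x]
   can be replaced by a representative of its code. *)
pose y (s : {ffun 'I_n -> bool * bool}) (i : 'I_n) : R :=
  if (s i).1 then 1 else if (s i).2 then 3 / 4 else 0.
have yh w : Vround eta A (x w) = Vround eta A (y (h w)).
  have IE : Iset (x w) = Iset (y (h w)).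
    apply/setP => i; rewrite !inE /y ffunE /=.
    by case: leP => _; case: ltP => _; apply/esym; rewrite ?lexx //; lra.
  have JE : Jset (x w) = Jset (y (h w)).
    apply/setP => i; rewrite !inE /y ffunE /=.
    case: (leP 1 (x w i)) => _ /=; first by rewrite andbF ltxx andbF.
    by rewrite andbT; case: ltP => _; lra.
  by rewrite /Vround /Itil IE JE.
under eq_set do rewrite yh.
apply: (measurable_finite_code (h := h)
  (fun s => (k <= #|Vround eta A (y s)|)%N)) => s.
have -> : [set w | h w = s]%classic = (\bigcap_(i in [set: 'I_n])
   ([set w | (1 <= x w i) = (s i).1] `&` [set w | (1 / 2 < x w i) = (s i).2]))%classic.
  apply/seteqP; split => w /=.
    by move=> <- i _; rewrite !ffunE.
  move=> H; apply/ffunP => i; rewrite ffunE.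
  by have [-> ->] := H i I; case: (s i).
apply: fin_bigcap_measurable; first exact: finite_finset.
move=> i _; apply: measurableI.
  have := measurable_fun_ler (measurable_cst (1 : R)) (mx i).
  move=> /(_ measurableT [set (s i).1]%classic I).
  by rewrite setTI.
have := measurable_fun_ltr (measurable_cst (1 / 2 : R)) (mx i).
move=> /(_ measurableT [set (s i).2]%classic I).
by rewrite setTI.
Qed.

(** Energy and failure probability are both averages over [w], so one [w] keeps each within a factor
    3. The positive [tau] stands in for [delta], which may be zero or negative. *)
Lemma exists_good_sample (R : realType) (n r D k : nat) (p delta tau xi eta : R)
    (dT : measure_display) (T : measurableType dT) (P : probability T R)
    (f : (redge n r -> R) -> T -> 'I_n -> R) :
  0 <= p <= 1 -> 0 < xi -> (0 < k)%N -> 0 < tau -> delta <= tau ->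
  random_poly D f -> optimizes p k delta xi eta P f ->
  exists w,
    pexp p (fun A => \sum_i f (aval R A) w i ^+ 2) <= 3 * (xi * k%:R) /\
    pexp p (fun A => (#|Vround eta A (f (aval R A) w)| < k)%N%:R) <= 3 * tau.
Proof.
move=> p01 xi0 k0 tau0 dt [_ mf] [opt1 opt2].
pose F1 (A : hgraph n r) w : R := \sum_i f (aval R A) w i ^+ 2.
pose F2 (A : hgraph n r) w : R := (#|Vround eta A (f (aval R A) w)| < k)%N%:R.
have F10 A w : 0 <= F1 A w by apply: sumr_ge0 => i _; exact: sqr_ge0.
have mF1 A : measurable_fun setT (F1 A).
  by apply: measurable_sum => i; apply: measurable_funX.
pose S A := [set w | (k <= #|Vround eta A (f (aval R A) w)|)%N]%classic.
have mS A : measurable (S A) by apply: measurable_Vround => i; exact: mf.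
have F2E A : F2 A = \1_(~` S A)%classic.
  apply/funext => w; rewrite /F2 indicE; congr (nat_of_bool _)%:R.
  apply/idP/idP => [H|/set_mem H].
    by apply/mem_set => /=; apply/negP; rewrite -ltnNge.
  by rewrite ltnNge; exact/negP.
have F20 A w : 0 <= F2 A w by [].
have mF2 A : measurable_fun setT (F2 A).
  by rewrite F2E; apply: measurable_indic; exact: measurableC.
have [mX1 I1] := integral_pexp P p01 F10 mF1.
have [mX2 I2] := integral_pexp P p01 F20 mF2.
have /andP[p0 p1] := p01.
apply: (@exists_both_small R dT T P (fun w => pexp p (F1^~ w))
  (fun w => pexp p (F2^~ w))) => //.
- by rewrite mulr_gt0 ?ltr0n.
- by move=> w; apply: pexp_ge0.
- by move=> w; apply: pexp_ge0.
- by rewrite I1.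
pose q A : R := fine (P (S A)).
have qE A : P (S A) = (q A)%:E by rewrite fineK // fin_num_measure.
rewrite I2.
have -> : (\sum_(Y : hgraph n r) (hprob p Y)%:E * \int[P]_w (F2 Y w)%:E)%E =
    (pexp p (fun Y : hgraph n r => 1 - q Y))%:E.
  rewrite /pexp -sumEFin; apply: eq_bigr => A _; rewrite EFinM; congr (_ * _)%E.
  rewrite F2E integral_indic //; last exact: measurableC.
  rewrite setIT; apply: etrans (probability_setC P (mS A)) _.
  by rewrite qE.
move: opt2; under eq_bigr do rewrite qE -EFinM.
rewrite sumEFin !lee_fin => opt2; apply: le_trans dt.
have -> : pexp p (fun Y : hgraph n r => 1 - q Y) = 1 - pexp p (fun Y : hgraph n r => q Y).
  apply/eqP; rewrite eq_sym subr_eq eq_sym -pexpD; apply/eqP.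
  by rewrite -[RHS](pexp1 (redge n r) p); apply: eq_pexp => Y; rewrite subrK.
by move: opt2; rewrite /pexp /hprob; lra.
Qed.

(** * Numerical estimates *)

Section Estimates.
Variable R : realType.
Implicit Types (n r a b j K : nat) (p x y L N eps d : R).

(** Compares one term of the expansion of [(1 + x) ^+ n] with [expR (n%:R * x)]. *)
Lemma bin_le_expR n j x L : 0 < x -> - ln x <= L ->
  'C(n, j)%:R <= expR (n%:R * x + j%:R * L).
Proof.
move=> x0 xL.
have [jn|nj] := leqP j n; last by rewrite bin_small ?expR_ge0.
have H : 'C(n, j)%:R * x ^+ j <= expR (n%:R * x).
  apply: (@le_trans _ _ ((1 + x) ^+ n)); last first.
    by rewrite expRM_natl lerXn2r ?nnegrE ?expR_ge0 ?expR_ge1Dx //; lra.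
  rewrite exprDn (bigD1 (inord j)) //= inordK ?ltnS // expr1n mul1r mulr_natl.
  rewrite lerDl sumr_ge0 // => i _.
  by rewrite mulrn_wge0 // mulr_ge0 ?exprn_ge0 ?ltW.
rewrite expRD (expRM_natl j) -ler_pdivrMr ?exprn_gt0 ?expR_gt0 //.
apply: le_trans H; rewrite ler_wpM2l // -exprVn lerXn2r ?nnegrE ?invr_ge0 ?expR_ge0 ?(ltW x0) //.
rewrite -expRN -[leRHS]lnK ?posrE // ler_expR; lra.
Qed.

Lemma expr_1B_le_expR p j : p <= 1 -> (1 - p) ^+ j <= expR (- (p * j%:R)).
Proof.
move=> p1; rewrite -mulNr expRM_natr lerXn2r ?nnegrE ?expR_ge0 ?subr_ge0 //.
exact: expR_ge1Dx.
Qed.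

Lemma pow2_le_expR j : (2 ^ j)%:R <= expR j%:R :> R.
Proof.
rewrite natrX -[j%:R in leRHS]mulr1 expRM_natl lerXn2r ?nnegrE ?expR_ge0 //.
by have := expR_ge1Dx (1 : R); lra.
Qed.

Lemma ffact_le_expn n j : (n ^_ j <= n ^ j)%N.
Proof.
by elim: j => // j IH; rewrite ffactnSr expnSr leq_mul // leq_subr.
Qed.

Lemma expn_le_ffact n i j : (i <= j)%N -> ((n - j) ^ i <= n ^_ i)%N.
Proof.
elim: i => // i IH ij; rewrite ffactnSr expnSr leq_mul ?IH ?(ltnW ij) //.
by rewrite leq_sub2l // ltnW.
Qed.

(** In falling factorials, the right side is at least [(a - j) ^ j] and the left at most
    [(y * n) ^ j]. *)
Lemma bin_ratio n a j y : 0 <= y -> y * n%:R + j%:R <= a%:R ->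
  y ^+ j * 'C(n.-1, j)%:R <= 'C(a, j)%:R.
Proof.
move=> y0 ya; rewrite -(ler_pM2r (_ : 0 < j`!%:R)) ?ltr0n ?fact_gt0 //.
rewrite -mulrA -!natrM !bin_ffact.
have ja : (j <= a)%N.
  rewrite -(ler_nat R); apply: le_trans ya; rewrite lerDr mulr_ge0 //.
apply: (@le_trans _ _ (((a - j) ^ j)%N%:R)); last by rewrite ler_nat expn_le_ffact.
apply: (@le_trans _ _ ((y * n%:R) ^+ j)).
  rewrite exprMn ler_wpM2l ?exprn_ge0 // -natrX ler_nat.
  apply: leq_trans (ffact_le_expn _ _) _.
  by case: (j) => [|j'] //; rewrite leq_exp2r // leq_pred.
by rewrite natrX lerXn2r ?nnegrE ?mulr_ge0 // natrB //; lra.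
Qed.

Lemma bin_ge_sub n j : (0 < j)%N -> (j <= n)%N -> (n - j < 'C(n, j))%N.
Proof.
case: j => // j _; elim: n j => // n IH [|j] jn; first by rewrite bin1; lia.
rewrite ltnS in jn; rewrite binS.
have [e|] := eqVneq j.+1 n; first by rewrite e binn; lia.
move=> ne; have := IH j.+1; have := IH j jn => H1 H2.
have := H2 ltac:(lia); have : (0 < 'C(n, j.+1))%N by rewrite bin_gt0; lia.
lia.
Qed.

Lemma bern_entropy_ge0 p : 0 < p -> p < 1 -> 0 <= bern_entropy p.
Proof.
move=> p0 p1; rewrite /bern_entropy opprD addr_ge0 //.
  by rewrite -mulrN mulr_ge0 ?(ltW p0) // oppr_ge0 ln_le0 // ltW.
by rewrite -mulrN mulr_ge0 ?subr_ge0 ?(ltW p1) // oppr_ge0 ln_le0 // gerBl ltW.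
Qed.

Lemma bern_entropy_le p : 0 < p -> p < 1 -> bern_entropy p <= p * (1 - ln p).
Proof.
move=> p0 p1; have q0 : 0 < 1 - p by rewrite subr_gt0.
have : - ln (1 - p) <= (1 - p)^-1 - 1.
  rewrite -lnV ?posrE //.
  have : -1 < (1 - p)^-1 - 1 by rewrite ltrBrDr addNr invr_gt0.
  by move=> /le_ln1Dx; rewrite addrC subrK.
move=> /(ler_wpM2l (ltW q0)); rewrite mulrBr mulfV ?gt_eqF // /bern_entropy; lra.
Qed.

Lemma exists_nat_near x : 0 <= x ->
  exists2 a : nat, x <= a%:R & a%:R <= x + 1.
Proof.
move=> x0; exists (Num.truncn x).+1; have /andP[l h] := truncn_itv x0.
  exact: ltW.
by rewrite -natr1 lerD2r.
Qed.

(** With [N = n * phi], each link gains [b * L * (1 + eps / 4)] against [b * L] for choosing the new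
    vertices. The surplus over [K] links is at least [4 * N * L]: the initial set costs [2 * N * L],
    the lower-order terms [N * L + N / 2], and [N / 2] is left. *)
Lemma chain_total n r K a b p phi L eps :
  0 < phi -> - ln phi <= L -> 0 <= p -> p <= 1 -> 0 < eps ->
  eps / 8 * (n%:R * phi) <= b%:R -> b%:R <= n%:R * phi ->
  a%:R <= 2 * (n%:R * phi) -> L * (1 + eps / 4) <= p * 'C(a, r.-1)%:R ->
  128 <= K%:R * eps ^+ 2 -> 1 + K%:R * (K%:R + 3) <= L ->
  K%:R * ln ((K * #|{: redge n r}|).+1%:R) <= n%:R * phi / 2 ->
  'C(n, a)%:R * link_rate n r p K a b (a + K * b) ^+ K <=
  expR (- (n%:R * phi / 2)).
Proof.
move=> phi0 phiL p0 p1 eps0; set N := n%:R * phi => bl bN aN pL Ke KL.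
set t := ln _ => tN.
have K0 : 0 <= K%:R :> R by [].
have L0 : 1 <= L by move: KL; nra.
have N0 : 0 <= N by rewrite mulr_ge0 // ltW.
have link_le : link_rate n r p K a b (a + K * b) <=
    expR (t + (a + K * b)%N%:R + (N + b%:R * L) - b%:R * (L * (1 + eps / 4))).
  rewrite /link_rate !expRD !natrM; apply: ler_pM => //.
  - by rewrite exprn_ge0 ?subr_ge0.
  - apply: ler_pM => //; last by rewrite -expRD; exact: bin_le_expR.
    apply: ler_pM => //; last exact: pow2_le_expR.
    by rewrite /t lnK ?posrE ?ltr0n.
  - apply: le_trans (expr_1B_le_expR _ p1) _; rewrite ler_expR lerN2 natrM.
    by rewrite [leRHS]mulrCA ler_wpM2l.
apply: le_trans (ler_pM _ _ (bin_le_expR n a phi0 phiL)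
  (lerXn2r K _ _ link_le)) _ => //; rewrite ?nnegrE ?exprn_ge0 ?link_rate_ge0 ?expR_ge0 //.
rewrite -expRM_natl -expRD ler_expR -/N natrD natrM.
have aL : a%:R * L <= 2 * N * L by rewrite ler_wpM2r //; lra.
have KN : N * (1 + K%:R * (K%:R + 3)) <= N * L by rewrite ler_wpM2l.
have NL : N <= N * L by rewrite ler_peMr.
have Kab : K%:R * (a%:R + K%:R * b%:R) <= K%:R * (2 * N + K%:R * N).
  by rewrite ler_wpM2l // lerD // ler_wpM2l.
have gain : 4 * (N * L) <= K%:R * (b%:R * (L * (eps / 4))).
  apply: (@le_trans _ _ (K%:R * (eps / 8 * N * (L * (eps / 4))))).
    have -> : K%:R * (eps / 8 * N * (L * (eps / 4))) =
      (K%:R * eps ^+ 2) / 32 * (N * L) by field.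
    by rewrite ler_wpM2r ?mulr_ge0 //; lra.
  by rewrite ler_wpM2l // ler_wpM2r ?mulr_ge0 //; lra.
lra.
Qed.

(** Since [r * 'C(a, r) = a * 'C(a.-1, r.-1)], the mean number of edges in an [a]-set is at least
    [N * (K + 3)], with [N = n * phi]; this beats [2 ^ (a + K * b)] and the factor [K]. *)
Lemma fresh_total n r K a b p phi L :
  0 < phi -> 0 <= p -> p <= 1 -> (0 < r)%N ->
  n%:R * phi <= a%:R -> a%:R <= 2 * (n%:R * phi) -> b%:R <= n%:R * phi ->
  L <= p * 'C(a.-1, r.-1)%:R -> r%:R * (K%:R + 3) <= L ->
  2 * K%:R <= n%:R * phi ->
  K%:R * ((2 ^ (a + K * b))%:R * (1 - p) ^+ 'C(a, r)) <=
  expR (- (n%:R * phi / 2)).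
Proof.
move=> phi0 p0 p1 r0; set N := n%:R * phi => aN aN2 bN pL rL KN.
have N0 : 0 <= N by rewrite mulr_ge0 // ltW.
have rR : 0 < r%:R :> R by rewrite ltr0n.
have edges : N * (K%:R + 3) <= p * 'C(a, r)%:R.
  rewrite -(ler_pM2l rR).
  have -> : r%:R * (p * 'C(a, r)%:R) = a%:R * (p * 'C(a.-1, r.-1)%:R).
    rewrite mulrCA [RHS]mulrCA -!natrM; congr (_ * _%:R).
    case: (r) r0 => // r' _; case: (a) => [|a']; last by rewrite -mul_bin_diag.
    by rewrite bin0n muln0.
  have h : 0 <= r%:R * (K%:R + 3) :> R by rewrite mulr_ge0 // addr_ge0.
  rewrite [leLHS]mulrCA; apply: ler_pM => //.
  exact: le_trans rL pL.
have KE : K%:R <= expR (N / 2) by have := expR_ge1Dx (N / 2); lra.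
apply: le_trans (ler_pM _ _ KE (ler_pM _ _ (pow2_le_expR _) (expr_1B_le_expR _ p1))) _;
  rewrite ?mulr_ge0 ?exprn_ge0 ?subr_ge0 //.
rewrite -!expRD ler_expR natrD natrM.
have : K%:R * b%:R <= K%:R * N by rewrite ler_wpM2l.
move: edges; lra.
Qed.

End Estimates.

Section EdgeDensity.
Variable R : realType.
Implicit Types (n r a K D k : nat) (p d c x y Z C phi L eps xi : R).

Lemma card_redge n r : #|{: redge n r}| = 'C(n, r).
Proof.
have := card_edges_in r [set: 'I_n]%SET; rewrite cardsT card_ord => <-.
by apply: eq_card => e; rewrite !inE finset.subsetT.
Qed.

Lemma times_le n r K : (0 < n)%N ->
  (K * #|{: redge n r}|).+1%:R <= (K%:R + 1) * n%:R ^+ r :> R.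
Proof.
move=> n0; rewrite card_redge -natrX natr1 -natrM ler_nat mulSn addnC -addn1 leq_add //.
  rewrite leq_mul2l; apply/orP; right.
  by apply: leq_trans (ffact_le_expn n r); rewrite -bin_ffact leq_pmulr ?fact_gt0.
by rewrite expn_gt0 n0.
Qed.

Lemma edge_prob_bounds n r d : (2 <= r)%N -> 1 <= d -> 2 * d + r%:R <= n%:R ->
  let p := d / 'C(n.-1, r.-1)%:R in
  [/\ 0 < p, p <= 1 / 2 & - ln p <= (r%:R - 1) * ln n%:R].
Proof.
move=> r2 d1 nd; have r0 : (0 < r)%N by rewrite (leq_trans _ r2).
have rn : (r <= n)%N by rewrite -(ler_nat R); lra.
have n0 : (0 < n)%N by rewrite (leq_trans r0).
have rn1 : (r.-1 <= n.-1)%N by rewrite -!subn1 leq_sub2r.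
have C0 : 0 < 'C(n.-1, r.-1)%:R :> R by rewrite ltr0n bin_gt0.
have d0 : 0 < d by lra.
have nR : 0 < n%:R :> R by rewrite ltr0n.
split; first by rewrite divr_gt0.
  rewrite ler_pdivrMr //.
  have : (n - r < 'C(n.-1, r.-1))%N.
    rewrite -[X in (X - _)%N](prednK n0) -[X in (_ - X)%N](prednK r0) subSS.
    by apply: bin_ge_sub; rewrite // -subn1 subn_gt0.
  by rewrite -(ltr_nat R) natrB //; lra.
have -> : r%:R - 1 = (r.-1)%:R :> R by rewrite -subn1 natrB.
rewrite -lnV ?posrE ?divr_gt0 // invfM invrK mulr_natl -lnXn //.
rewrite ler_ln ?posrE ?mulr_gt0 ?invr_gt0 ?exprn_gt0 //.
rewrite mulrC ler_pdivrMr //.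
apply: (@le_trans _ _ (n%:R ^+ r.-1)); last by rewrite ler_peMr ?exprn_ge0.
rewrite -natrX ler_nat; apply: (@leq_trans (n.-1 ^_ r.-1)).
  by rewrite -bin_ffact leq_pmulr ?fact_gt0.
apply: leq_trans (ffact_le_expn _ _) _.
by case: (r.-1) => [|j'] //; rewrite leq_exp2r // leq_pred.
Qed.

(** The entropy is at most [p * r * ln n]; its factor [p] cancels the one in the influence bound,
    and [k <= n] cancels [n], so the constant is free of [n]. *)
Lemma walk_loss n r K D k p c xi : 0 < p -> p <= 1 / 2 ->
  - ln p <= (r%:R - 1) * ln n%:R -> 1 <= ln (n%:R : R) -> (k <= n)%N -> (0 < n)%N ->
  0 < c -> 0 <= xi ->
  bern_entropy p * (K%:R * (D%:R * (3 * (xi * k%:R)) / (p * (1 - p) * (c * n%:R))))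
  <= 6 * r%:R * K%:R / c * (xi * D%:R * ln n%:R).
Proof.
move=> p0 p2 lnp ln1n kn n0 c0 xi0.
have p1 : p < 1 by lra.
have nR : 0 < n%:R :> R by rewrite ltr0n.
have hp : bern_entropy p <= p * (r%:R * ln n%:R).
  by apply: le_trans (bern_entropy_le p0 p1) _; rewrite ler_pM2l //; lra.
have kR : k%:R <= n%:R :> R by rewrite ler_nat.
have q0 : 0 < 1 - p by lra.
have ln0 : 0 <= ln (n%:R : R) by lra.
have E0 : 0 <= K%:R * (D%:R * (3 * (xi * k%:R)) / (p * (1 - p) * (c * n%:R))).
  by rewrite mulr_ge0 // divr_ge0 ?mulr_ge0 ?(ltW p0) ?(ltW q0) ?(ltW c0).
apply: le_trans (ler_wpM2r E0 hp) _.
have -> : p * (r%:R * ln n%:R) * (K%:R * (D%:R * (3 * (xi * k%:R)) / (p * (1 - p) * (c * n%:R)))) =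
   3 * r%:R * K%:R / c * (xi * D%:R * ln n%:R) * ((k%:R / n%:R) * (1 - p)^-1).
  by field; rewrite !gt_eqF.
have -> : 6 * r%:R * K%:R / c * (xi * D%:R * ln n%:R) =
    3 * r%:R * K%:R / c * (xi * D%:R * ln n%:R) * (1 * 2).
  by field; rewrite gt_eqF.
rewrite ler_wpM2l // ?mulr_ge0 ?invr_ge0 ?(ltW c0) //.
apply: ler_pM; rewrite ?divr_ge0 ?invr_ge0 ?(ltW q0) //.
  by rewrite ler_pdivrMr // mul1r.
by rewrite -[leLHS]mul1r ler_pdivrMr //; lra.
Qed.

(** The extra [(r + 2) * Z] in the exponent pays for [n ^ r.+1]: the path has of order [n ^ r]
    times, and the spare [n] absorbs the constants. *)
Lemma failures_small n r K C Z (m : nat) : (0 < n)%N ->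
  m%:R <= (K%:R + 1) * n%:R ^+ r :> R -> 9 * (K%:R + 1) <= n%:R :> R ->
  0 <= ln (n%:R : R) <= Z ->
  m%:R * (3 * expR (- ((C + r%:R + 2) * Z))) <= expR (- (C * Z)) / 3.
Proof.
move=> n0 mle n9 /andP[l0 Zl].
have nR : 0 < n%:R :> R by rewrite ltr0n.
have rZ : r%:R * ln n%:R <= r%:R * Z by rewrite ler_wpM2l.
have tauE : expR (- ((C + r%:R + 2) * Z)) <= expR (- (C * Z)) / n%:R ^+ r.+1.
  rewrite -addrA mulrDl opprD expRD ler_wpM2l ?expR_ge0 //.
  rewrite -[X in _ <= X ^-1]lnK ?posrE ?exprn_gt0 // -expRN ler_expR lnXn //.
  by rewrite -mulr_natl -addn1 natrD lerN2 !mulrDl; lra.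
apply: (@le_trans _ _ ((K%:R + 1) * n%:R ^+ r * (3 * (expR (- (C * Z)) / n%:R ^+ r.+1)))).
  by apply: ler_pM => //; rewrite ?mulr_ge0 ?expR_ge0 // ler_wpM2l.
rewrite exprSr invfM.
have -> : (K%:R + 1) * n%:R ^+ r * (3 * (expR (- (C * Z)) * ((n%:R ^+ r)^-1 * n%:R^-1))) =
   expR (- (C * Z)) * ((K%:R + 1) * 3 / n%:R) * (n%:R ^+ r / n%:R ^+ r) by ring.
rewrite divff ?expf_eq0 ?gt_eqF ?andbF // mulr1 ler_wpM2l ?expR_ge0 //.
by rewrite ler_pdivrMr //; lra.
Qed.

(** Exceeding the scale [n * phi] by the factor [1 + eps / 4] multiplies [d * phi ^+ r.-1 = L] by a
    power of it with exponent [r.-1 >= 1]. *)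
Lemma star_edge_rate n r a d phi L eps : (2 <= r)%N -> (r <= n)%N ->
  0 <= d -> 0 <= phi -> 0 <= eps -> d * phi ^+ r.-1 = L ->
  (1 + eps / 4) * (n%:R * phi) + (r%:R - 1) <= a%:R ->
  L * (1 + eps / 4) <= d / 'C(n.-1, r.-1)%:R * 'C(a, r.-1)%:R.
Proof.
move=> r2 rn d0 phi0 eps0 dphi.
have e1 : 1 <= 1 + eps / 4 by lra.
have C0 : 0 < 'C(n.-1, r.-1)%:R :> R by rewrite ltr0n bin_gt0 -!subn1 leq_sub2r.
have y0 : 0 <= (1 + eps / 4) * phi by rewrite mulr_ge0 //; lra.
have -> : r%:R - 1 = (r.-1)%:R :> R by rewrite -subn1 natrB // (leq_trans _ r2).
rewrite [n%:R * phi]mulrC mulrA => /(bin_ratio y0) H.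
rewrite mulrAC -mulrA.
apply: (@le_trans _ _ (d * (((1 + eps / 4) * phi) ^+ r.-1))); last first.
  by rewrite ler_wpM2l // ler_pdivlMr.
rewrite exprMn mulrCA dphi mulrC ler_wpM2r //.
  by rewrite -dphi mulr_ge0 ?exprn_ge0.
case: (r) r2 => [|[|r']] // _.
by rewrite /= exprS ler_peMr ?exprn_ege1 //; lra.
Qed.

End EdgeDensity.

(** * Contradiction at the critical density and choice of the constants *)

Lemma no_good_map (R : realType) (n r K D k : nat) (d phi L eps xi : R)
    (g : hgraph n r -> 'I_n -> R) :
  let c := eps * phi / 64 in
  let p := d / 'C(n.-1, r.-1)%:R in
  let Z := xi * D%:R * ln n%:R in
  let C := 6 * r%:R * K%:R / c in
  (2 <= r)%N -> 1 <= d -> 0 < phi -> d * phi ^+ r.-1 = L ->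
  - ln phi <= L -> 0 < eps -> eps <= 1 ->
  128 <= K%:R * eps ^+ 2 -> 1 + K%:R * (K%:R + 3) <= L -> r%:R * (K%:R + 3) <= L ->
  1 <= ln (n%:R : R) -> 20 <= n%:R * phi -> r%:R <= eps / 4 * (n%:R * phi) ->
  12 <= eps * (n%:R * phi) ->
  2 * K%:R <= n%:R * phi -> 2 * d + r%:R <= n%:R -> 9 * (K%:R + 1) <= n%:R :> R ->
  K%:R * ((r%:R + 1) * ln n%:R) <= n%:R * phi / 2 ->
  0 <= xi -> ln n%:R <= Z -> 0 <= C * Z -> C * Z <= n%:R * phi / 4 ->
  n%:R * (1 + eps) * phi <= k%:R ->
  (forall i, low_degree p D (fun A => g A i)) ->
  pexp p (fun A => \sum_i g A i ^+ 2) <= 3 * (xi * k%:R) ->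
  pexp p (fun A => (#|Vround (eps * phi / 16) A (g A)| < k)%N%:R) <=
    3 * expR (- ((C + r%:R + 2) * Z)) ->
  False.
Proof.
move=> c p Z C r2 d1 phi0 dphi phiL eps0 eps1 Ke KL rL ln1n.
set N := n%:R * phi => N20 Nr N12 NK nd n9 lnN xi0 Zl CZ0 ZN kN gD Mg Fg.
have [p0 p2 lnp] := edge_prob_bounds r2 d1 nd.
have r0 : (0 < r)%N by rewrite (leq_trans _ r2).
have rn : (r <= n)%N by rewrite -(ler_nat R); move: nd d1; clear; lra.
have n0 : (0 < n)%N by rewrite (leq_trans r0).
have c0 : 0 < c by rewrite divr_gt0 ?mulr_gt0.
have d0 : 0 <= d by apply: le_trans d1.
have p1 : p < 1 by move: p2; rewrite -/p; clear; lra.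
have NE : N = n%:R * phi by [].
have kN' : (1 + eps) * N <= k%:R by apply: le_trans kN; rewrite NE mulrAC mulrC.
clearbody N.
have N0 : 0 <= N by move: N20; clear; lra.
have eN : eps * N <= N by rewrite ler_piMl.
(* [a] lies near [(1 + eps / 2) * N]: above the rate threshold [(1 + eps / 4) * N] with room for
   [r - 1], and below [k - 2 * b] as [b] is near [eps * N / 8]. *)
have [a a1 a2] := @exists_nat_near R (N + eps * N / 2)
  ltac:(move: N0 N12; clear; lra).
have [b b1 b2] := @exists_nat_near R (eps * N / 8) ltac:(move: N12; clear; lra).
have k0 : (0 < k)%N.
  by rewrite -(ltr_nat R); move: kN' N12 N0; rewrite mulrDl; clear; lra.
have small := failures_small C n0 (times_le R r K n0) n9
  (introT andP (conj (le_trans ler01 ln1n) Zl)).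
have e1 : expR (- (C * Z)) <= 1 by rewrite -expR0 ler_expR oppr_le0.
(* For [k > n] every rounding is too small, against the failure bound. *)
have kn : (k <= n)%N.
  rewrite leqNgt; apply/negP => nk.
  have F1 : 1 <= 3 * expR (- ((C + r%:R + 2) * Z)).
    apply: le_trans Fg; rewrite -[leLHS](pexp1 (redge n r) p).
    apply: le_pexp => [||A]; [exact: ltW|exact: ltW|].
    rewrite (leq_ltn_trans _ nk) //.
    by apply: leq_trans (max_card _) _; rewrite card_ord.
  have F2 : 3 * expR (- ((C + r%:R + 2) * Z)) <= expR (- (C * Z)) / 3.
    by apply: le_trans small; rewrite ler_peMl ?ler1n // mulr_ge0 ?expR_ge0.
  by move: e1 F1 F2; clear; lra.
have [e0 _] : exists e : redge n r, True.
  have rT : (r <= #|[set: 'I_n]%SET|)%N by rewrite cardsT card_ord.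
  by have [S _ Sr] := subset_card_exists rT; exists (Sub S Sr).
have rate (j : nat) : (1 + eps / 4) * N + (r%:R - 1) <= j%:R ->
    L * (1 + eps / 4) <= p * 'C(j, r.-1)%:R.
  by rewrite NE; apply: star_edge_rate => //; exact: ltW.
have a0 : (0 < a)%N by rewrite -(ltr_nat R); move: a1 N12 N0 N20; clear; lra.
have aR : (a.-1)%:R = a%:R - 1 :> R by rewrite -subn1 natrB.
have rate_a : L * (1 + eps / 4) <= p * 'C(a, r.-1)%:R.
  by apply: rate; rewrite mulrDl; move: a1 Nr; clear; lra.
have L0 : 0 <= L by rewrite -dphi mulr_ge0 ?exprn_ge0 // ltW.
have rate_a1 : L <= p * 'C(a.-1, r.-1)%:R.
  apply: (@le_trans _ _ (L * (1 + eps / 4))); first by rewrite ler_peMr // lerDl divr_ge0 // ltW.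
  by apply: rate; rewrite mulrDl aR; move: a1 Nr; clear; lra.
have tN : K%:R * ln ((K * #|{: redge n r}|).+1%:R) <= N / 2.
  apply: le_trans lnN; rewrite ler_wpM2l //.
  have nR : 0 < n%:R :> R by rewrite ltr0n.
  have -> : (r%:R + 1) * ln n%:R = ln (n%:R ^+ r.+1) :> R.
    by rewrite lnXn // natr1 mulr_natl.
  rewrite ler_ln ?posrE ?ltr0n ?exprn_gt0 //; apply: le_trans (times_le R r K n0) _.
  rewrite exprS ler_wpM2r ?exprn_ge0 //.
  by have K0 : 0 <= K%:R :> R by []; move: n9 K0; clear; lra.
have aN : a%:R <= 2 * N by move: a2 eN N20; clear; lra.
have bN : b%:R <= N by move: b2 eN N20; clear; lra.
have Na : N <= a%:R by move: a1 N12; clear; lra.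
have b1' : eps / 8 * N <= b%:R by rewrite mulrAC.
have chainN : 'C(n, a)%:R * link_rate n r p K a b (a + K * b) ^+ K <= expR (- (N / 2)).
  by rewrite NE in N20 Nr N12 NK lnN tN aN bN b1' *;
    apply: (@chain_total R n r K a b p phi L eps) => //; exact: ltW.
have freshN : K%:R * ((2 ^ (a + K * b))%:R * (1 - p) ^+ 'C(a, r)) <= expR (- (N / 2)).
  by rewrite NE in NK aN bN Na *;
    apply: (@fresh_total R n r K a b p phi L) => //; exact: ltW.
apply: (@no_optimizing_map R n r p (eps * phi / 16) c (3 * (xi * k%:R))
  (3 * expR (- ((C + r%:R + 2) * Z))) K a b k (a + K * b) D g e0) => //.
- apply: le_trans b1; rewrite NE /c le_eqVlt; apply/orP; left; apply/eqP.
  by clear; field.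
- rewrite -(ler_nat R) natrD natrM; apply: le_trans kN'; rewrite mulrDl.
  by move: a2 b2 N12; clear; lra.
- exact: bern_entropy_ge0.
(* Failures take a third of [expR (- (C * Z))], chains and fresh overlaps at most a sixth each. *)
apply: (@lt_le_trans _ _ (expR (- (C * Z)))); last first.
  by rewrite ler_expR lerN2; exact: walk_loss.
have EN : expR (- (N / 4)) <= expR (- (C * Z)).
  by rewrite ler_expR lerN2.
have E4 : 6 <= expR (N / 4).
  by apply: le_trans (expR_ge1Dx (N / 4)); move: N20; clear; lra.
have E2 : 6 * expR (- (N / 2)) <= expR (- (N / 4)).
  have -> : - (N / 4) = N / 4 + - (N / 2) by clear; field.
  by rewrite expRD ler_wpM2r ?expR_ge0.
have Epos := expR_gt0 (- (C * Z)).
by move: chainN freshN small E2 EN Epos; clear; lra.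
Qed.

(** By definition [phi ^+ w = L / d], so [- ln phi = L - ln L / w], and [ln L >= 0] because
    [L >= M >= 1]. *)
Lemma density_scale (R : realType) (w : nat) (d M : R) : (0 < w)%N -> 1 <= M ->
  expR (w%:R * M) <= d ->
  let L := ln d / w%:R in
  let phi := (w%:R^-1 * (ln d / d)) `^ w%:R^-1 in
  [/\ 1 <= d, 0 < phi, d * phi ^+ w = L, - ln phi <= L & M <= L].
Proof.
move=> w0 M1 dM L phi.
have wR : 0 < w%:R :> R by rewrite ltr0n.
have M0 : 0 <= M by apply: le_trans M1.
have d1 : 1 <= d.
  by apply: le_trans dM; rewrite -expR0 ler_expR mulr_ge0.
have d0 : 0 < d by apply: lt_le_trans d1.
have ML : M <= L.
  by rewrite ler_pdivlMr // mulrC -[leLHS]expRK ler_ln ?posrE ?expR_gt0.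
have L0 : 0 < L by apply: lt_le_trans ML; apply: lt_le_trans M1.
have baseE : w%:R^-1 * (ln d / d) = L / d by rewrite /L; ring.
have base0 : 0 < w%:R^-1 * (ln d / d) by rewrite baseE divr_gt0.
split => //; first exact: powR_gt0.
  rewrite -powR_mulrn ?powR_ge0 // -powRrM mulVf ?gt_eqF // powRr1 ?ltW //.
  by rewrite baseE mulrC divfK ?gt_eqF.
rewrite ln_powR baseE ln_div ?posrE // -mulrN opprB mulrBr.
have -> : w%:R^-1 * ln d = L by rewrite mulrC.
by rewrite lerBlDr lerDl mulr_ge0 ?invr_ge0 ?ln_ge0 ?(ltW wR) // (le_trans M1).
Qed.

(** Splits [ln x = ln (x * y) + ln y^-1] and bounds each part by its argument; this gives an
    explicit threshold for [n]. *)
Lemma ln_le_linear (R : realType) (x y : R) : 0 < y -> y ^- 2 <= x ->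
  ln x <= 2 * x * y.
Proof.
move=> y0 yx; have x0 : 0 < x by apply: lt_le_trans yx; rewrite invr_gt0 exprn_gt0.
have -> : ln x = ln (x * y) + ln y^-1.
  by rewrite -lnM ?posrE ?mulr_gt0 ?invr_gt0 // mulfK ?gt_eqF.
have H1 : ln (x * y) <= x * y by rewrite ltW // ln_sublinear ?mulr_gt0.
have H2 : ln y^-1 <= y^-1 by rewrite ltW // ln_sublinear ?invr_gt0.
have H3 : y^-1 <= x * y.
  apply: le_trans (ler_wpM2r (ltW y0) yx).
  by rewrite expr2 invfM -mulrA mulVf ?mulr1 ?gt_eqF.
by move: H1 H2 H3; clear; lra.
Qed.

Theorem mainTheorem2 (R : realType) (eps : R) (r : nat) :
  0 < eps -> (2 <= r)%N ->
  exists dstar : R, 0 < dstar /\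
  forall d : R, dstar <= d ->
  exists eta C1 C2 nstar : R,
    [/\ 0 < eta, 0 < C1, 0 < C2 & 0 < nstar] /\
  forall (n : nat) (xi : R) (D : nat) (delta : R) (k : nat),
    nstar <= n%:R -> 1 <= xi ->
    (1 <= D)%N -> D%:R <= C1 * n%:R / (xi * ln (n%:R)) ->
    delta <= expR (- (C2 * xi * D%:R * ln (n%:R))) ->
    n%:R * (1 + eps) *
      (((r.-1)%:R)^-1 * (ln d / d)) `^ (((r.-1)%:R)^-1) <= k%:R ->
    let p := d / ('C(n.-1, r.-1))%:R in
    forall (dT : measure_display) (T : measurableType dT) (P : probability T R)
      (f : (redge n r -> R) -> T -> 'I_n -> R),
      random_poly D f -> ~ optimizes p k delta xi eta P f.
Proof.
move=> eps0 r2.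
(* Capping at 1 is harmless: the lower bound on [k] increases with [eps]. *)
pose e : R := Num.min eps 1.
have e0 : 0 < e by rewrite lt_min eps0 ltr01.
have e1 : e <= 1 by rewrite ge_min lexx orbT.
have ee : e <= eps by rewrite ge_min lexx.
pose K := (Num.truncn (128 / e ^+ 2)).+1.
have Ke : 128 <= K%:R * e ^+ 2.
  rewrite -ler_pdivrMr ?exprn_gt0 // ltW //.
  have E0 : 0 <= 128 / e ^+ 2 by rewrite divr_ge0 // exprn_ge0 // ltW.
  by have /andP[] := truncn_itv E0.
clearbody K.
have KR : 0 < K%:R :> R.
  by rewrite ltr0n lt0n; apply/eqP => K0; move: Ke; rewrite K0 mul0r; clear; lra.
have rR : 2 <= r%:R :> R by rewrite ler_nat.
have r0 : 0 < r%:R :> R by apply: lt_le_trans rR.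
have K30 : 0 <= K%:R + 3 :> R by rewrite addr_ge0.
(* Lower bound on [L] that serves both first-moment estimates; [dstar] enforces it. *)
pose M : R := (1 + K%:R * (K%:R + 3)) + r%:R * (K%:R + 3).
have M1 : 1 <= M by rewrite /M -addrA lerDl addr_ge0 ?mulr_ge0 // ltW.
exists (expR ((r.-1)%:R * M)); split; first exact: expR_gt0.
move=> d dM.
have w0 : (0 < r.-1)%N by rewrite -subn1 subn_gt0.
have [d1] := density_scale w0 M1 dM; cbv zeta.
set L := ln d / (r.-1)%:R; set phi := _ `^ _ => phi0 dphi phiL ML.
clearbody phi L.
have KL : 1 + K%:R * (K%:R + 3) <= L.
  by apply: le_trans ML; rewrite /M lerDl mulr_ge0 // ltW.
have rL : r%:R * (K%:R + 3) <= L.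
  by apply: le_trans ML; rewrite /M lerDr addr_ge0 // mulr_ge0 // ltW.
pose c := e * phi / 64.
have c0 : 0 < c by rewrite divr_gt0 ?mulr_gt0.
pose C := 6 * r%:R * K%:R / c.
have C0 : 0 < C by rewrite divr_gt0 ?mulr_gt0.
pose y := phi / (4 * (K%:R * (r%:R + 1))).
have r10 : 0 < r%:R + 1 :> R by rewrite addr_gt0.
have y0 : 0 < y by rewrite divr_gt0 // !mulr_gt0.
pose N0 : R := 20 + 4 * r%:R / e + 12 / e + 2 * K%:R.
have N01 : 0 <= 4 * r%:R / e by rewrite divr_ge0 ?mulr_ge0 // ltW.
have N02 : 0 <= 12 / e by rewrite divr_ge0 // ltW.
have NN0 : 0 <= N0 / phi by rewrite divr_ge0 ?(ltW phi0) // !addr_ge0.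
have yy0 : 0 <= y ^- 2 by rewrite invr_ge0 exprn_ge0 // ltW.
have E0 : 0 < expR 1 :> R by exact: expR_gt0.
(* [eta + 4 * c = e * phi / 8] matches [b]; [C1] is set so that [C * Z <= n * phi / 4]; [C2] adds
   [r + 2] to [C] for the union over path times. *)
exists (e * phi / 16), (c * phi / (24 * r%:R * K%:R)), (C + r%:R + 2),
  (expR 1 + N0 / phi + 2 * d + r%:R + 9 * (K%:R + 1) + y ^- 2).
split.
  split; [by rewrite divr_gt0 ?mulr_gt0|by rewrite divr_gt0 ?mulr_gt0| |].
    by move: C0 r0; clear; lra.
  by move: E0 NN0 yy0 d1 r0 KR; clear; lra.
move=> n xi D delta k nn xi1 D1 DC deltaC kN dT T P f fpoly.
set p := d / _ => opt.
have [nE nN nd n9 ny] : [/\ expR 1 <= n%:R :> R, N0 / phi <= n%:R :> R,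
   2 * d + r%:R <= n%:R, 9 * (K%:R + 1) <= n%:R :> R & y ^- 2 <= n%:R].
  by split; move: nn E0 NN0 yy0 d1 r0 KR; clear; lra.
have n0 : 0 < n%:R :> R by apply: lt_le_trans nE.
have ln1n : 1 <= ln (n%:R : R) by rewrite -[leLHS]expRK ler_ln ?posrE.
have ln0 : 0 < ln (n%:R : R) by apply: lt_le_trans ln1n.
move: nN; rewrite ler_pdivrMr // => nN.
have N20 : 20 <= n%:R * phi by move: nN N01 N02 KR; rewrite /N0; clear; lra.
have NK : 2 * K%:R <= n%:R * phi by move: nN N01 N02 KR; rewrite /N0; clear; lra.
have Nr : r%:R <= e / 4 * (n%:R * phi).
  rewrite -ler_pdivrMl ?divr_gt0 //.
  have -> : (e / 4)^-1 * r%:R = 4 * r%:R / e by field; rewrite gt_eqF.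
  by move: nN N01 N02 KR; rewrite /N0; clear; lra.
have N12 : 12 <= e * (n%:R * phi).
  rewrite mulrC -ler_pdivrMr //.
  by move: nN N01 N02 KR; rewrite /N0; clear; lra.
have xi0 : 0 < xi by apply: lt_le_trans xi1.
pose Z := xi * D%:R * ln n%:R.
have Zl : ln n%:R <= Z.
  by rewrite ler_peMl ?(ltW ln0) // mulr_ege1 // ler1n.
have lnN : K%:R * ((r%:R + 1) * ln n%:R) <= n%:R * phi / 2.
  have := ln_le_linear y0 ny; rewrite mulrA -(ler_pM2l (mulr_gt0 KR r10)).
  move=> /le_trans; apply; rewrite /y le_eqVlt; apply/orP; left; apply/eqP.
  by field; rewrite !gt_eqF.
have CZ : C * Z <= n%:R * phi / 4.
  have ZC : Z <= c * phi / (24 * r%:R * K%:R) * n%:R.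
    have -> : Z = D%:R * (xi * ln n%:R) by rewrite /Z; ring.
    by rewrite -ler_pdivlMr // mulr_gt0.
  apply: le_trans (ler_wpM2l (ltW C0) ZC) _.
  rewrite /C le_eqVlt; apply/orP; left; apply/eqP.
  by field; rewrite !gt_eqF.
have k0 : (0 < k)%N.
  by rewrite -(ltr_nat R); apply: lt_le_trans kN; rewrite !mulr_gt0 // addr_gt0.
have [p0 p2 _] := edge_prob_bounds r2 d1 nd.
have p01 : 0 <= p <= 1 by rewrite (ltW p0) /=; move: p2; rewrite -/p; clear; lra.
have deltaZ : delta <= expR (- ((C + r%:R + 2) * Z)).
  by apply: le_trans deltaC _; rewrite /Z !mulrA.
have [w [Mw Fw]] := exists_good_sample p01 xi0 k0 (expR_gt0 _) deltaZ fpoly opt.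
apply: (@no_good_map R n r K D k d phi L e xi (fun A => f (aval R A) w)) => //.
- exact: ltW.
- by rewrite mulr_ge0 // ltW // (lt_le_trans ln0).
- apply: le_trans kN; rewrite ler_pM2r // ler_pM2l // lerD2l //.
- move=> i; exact: (poly_deg_le_low_degree p (fpoly.1 w i)).
Qed.
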